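(* For $i=1,2$, let $K_i$ be a compact Hausdorff space, $E_i$ a Banach space not containing an isomorphic copy of $c_0$, and $\mathcal{H}_i$ a closed subspace of $\mathcal{C}(K_i,E_i)$ such that the Choquet boundary $\operatorname{Ch}_{\mathcal{H}_i}K_i$ is closed and countable and consists of weak peak points (with respect to $\mathcal{H}_i$). Suppose that for all natural numbers $m<n$, $E_1^m$ does not contain an isomorphic copy of $E_2^n$, and $E_2^m$ does not contain an isomorphic copy of $E_1^n$. If there exists a (surjective linear) isomorphism $T:\mathcal{H}_1\to\mathcal{H}_2$ with $\|T\|\,\|T^{-1}\|<3$, then $\operatorname{Ch}_{\mathcal{H}_1}K_1$ is homeomorphic to $\operatorname{Ch}_{\mathcal{H}_2}K_2$.
   Context: All topological spaces are Hausdorff; all Banach spaces are real and of dimension at least $1$ (this applies also to the subspaces $\mathcal{H}_i$). For a compact space $K$ and a Banach space $E$, $\mathcal{C}(K,E)$ is the space of continuous functions $K\to E$ with the norm $\|f\|=\sup_{x\in K}\|f(x)\|$, and $\mathcal{C}(K)=\mathcal{C}(K,\mathbb{R})$. For $f\in\mathcal{C}(K)$ and $e\in E$, $f\otimes e\in\mathcal{C}(K,E)$ is $x\mapsto f(x)e$. For $e^*\in E^*$ and $h\in \mathcal{C}(K,E)$, $e^*(h)\in\mathcal{C}(K)$ is $x\mapsto\langle e^*,h(x)\rangle$. Let $\mathcal{H}\subseteq\mathcal{C}(K,E)$ be a closed subspace. - The canonical scalar function space of $\mathcal{H}$ is $\mathcal{A}=$ the closed linear span of $\{e^*(h): e^*\in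 E^*,\ h\in\mathcal{H}\}$ in $\mathcal{C}(K)$, and $\mathcal{A}^E=\{h\in\mathcal{A}: h\otimes e\in\mathcal{H}\text{ for every } e\in E\}$. - The Choquet boundary $\operatorname{Ch}_{\mathcal{H}}K$ is the set of all $x\in K$ such that the evaluation functional $h\mapsto h(x)$, $h\in\mathcal{A}$, is an extreme point of the unit ball $B_{\mathcal{A}^*}$. - A point $x\in K$ is a weak peak point (with respect to $\mathcal{H}$) if for each neighbourhood $U$ of $x$ and each $\varepsilon\in(0,1)$ there is $h\in\mathcal{A}^E$ with $0\le h\le1$, $h(x)>1-\varepsilon$ and $h<\varepsilon$ on $\operatorname{Ch}_{\mathcal{H}}K\setminus U$. $E^n$ denotes the direct sum of $n$ copies of $E$; ''contains an isomorphic copy of'' means contains a subspace linearly isomorphic to. *)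

(* Defs.v *)
From HB Require Import structures.
From mathcomp Require Import all_boot all_order all_algebra.
From mathcomp Require Import all_classical all_reals all_analysis.

Set Implicit Arguments.
Unset Strict Implicit.
Unset Printing Implicit Defensive.

Import Order.TTheory GRing.Theory Num.Theory.
Import numFieldNormedType.Exports.

Local Open Scope classical_set_scope.
Local Open Scope ring_scope.

(* A normed space is presented as a linear subspace [D] of a left module [V],
   together with a function [V -> R] that is a norm on [D]; [D] also denotes
   the subtype [{u : V | u \in D}]. *)

Section NormedSubspaces.
Context {R : realType}.

Definition nontrivial (V : lmodType R) (D : set V) := exists2 u, D u & u != 0.

Definition linear_span (V : lmodType R) (S : set V) : set V :=
  [set v | exists n (a : 'I_n -> R) (u : 'I_n -> V),
     (forall i, S (u i)) /\ v = \sum_(i < n) a i *: u i].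

Definition extreme_points (V : lmodType R) (C : set V) : set V :=
  [set p | C p /\
     forall (x y : V) (t : R), C x -> C y -> 0 < t < 1 ->
       p = t *: x + (1 - t) *: y -> x = p /\ y = p].

Section Operators.
Variables (V W : lmodType R) (D : set V) (nV : V -> R) (nW : W -> R).

Definition linear_on (T : D -> W) :=
  forall (a : R) (u v w : D),
    set_val w = a *: set_val u + set_val v -> T w = a *: T u + T v.

Definition bounded_on (T : D -> W) :=
  exists M : R, forall u : D, nW (T u) <= M * nV (set_val u).

(* [sup] is the supremum of a bounded set only when [bounded_on T]. *)
Definition opnorm (T : D -> W) : R :=
  sup [set nW (T u) | u in [set u : D | nV (set_val u) <= 1]].

Definition contains_copy :=
  exists2 T : D -> W, linear_on T &
    exists c C : R, [/\ 0 < c, 0 < C &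
      forall u : D,
        c * nV (set_val u) <= nW (T u) /\ nW (T u) <= C * nV (set_val u)].

End Operators.

Definition dual_ball (V : lmodType R) (D : set V) (nV : V -> R) :
    set (D -> R^o) :=
  [set phi | [/\ linear_on phi,
     bounded_on nV (fun a : R^o => `|a|) phi &
     opnorm nV (fun a : R^o => `|a|) phi <= 1]].

End NormedSubspaces.

Definition supnorm (R : realType) (X : Type) (E : normedModType R)
    (f : X -> E) : R :=
  sup [set `|f x| | x in [set: X]].

Definition c0 (R : realType) : set (nat -> R^o) :=
  [set u | u n @[n --> \oo] --> (0 : R^o)].

(* [contains_c0 E]: E contains an isomorphic copy of c_0. *)
Definition contains_c0 (R : realType) (E : normedModType R) :=
  contains_copy (@c0 R) (@supnorm R nat R^o) (fun e : E => `|e|).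

(* [contains_power E m F n]: E^m contains an isomorphic copy of F^n.  Finite
   direct sums carry the maximum norm; all the usual norms are equivalent. *)
Definition contains_power (R : realType) (E : normedModType R) (m : nat)
    (F : normedModType R) (n : nat) :=
  contains_copy [set: 'I_n -> F] (@supnorm R 'I_n F) (@supnorm R 'I_m E).

Definition homeomorphic (X Y : topologicalType) :=
  exists (f : X -> Y) (g : Y -> X),
    [/\ cancel f g, cancel g f, continuous f & continuous g].

Section VectorFunctionSpaces.
Context {R : realType} {K : topologicalType} {E : completeNormedModType R}.

(* For compact K, uniform convergence is convergence for [supnorm], and
   C(K, E) is closed in [{uniform K -> E}]. *)
Definition closed_function_space (H : set (K -> E)) :=
  [/\ H `<=` [set h | continuous h],
      submod_closed [in H] &
      closed (H : set {uniform K -> E})].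

Variable H : set (K -> E).

Definition canonical_scalar_space : set (K -> R^o) :=
  closure (linear_span
    [set f : K -> R^o | exists2 e : {scalar E}, continuous e &
       exists2 h, H h & f = e \o h] : set {uniform K -> R^o}).

Definition multiplier_space : set (K -> R^o) :=
  [set h | canonical_scalar_space h /\
     forall e : E, H (fun x => h x *: e)].

Definition choquet_boundary : set K :=
  [set x | extreme_points
     (dual_ball (D := canonical_scalar_space) (@supnorm R K R^o))
     (fun h => set_val h x)].

Definition weak_peak_point (x : K) :=
  forall (U : set K) (eps : R), nbhs x U -> 0 < eps < 1 ->
    exists h : K -> R^o,
      [/\ multiplier_space h,
          (forall y, 0 <= h y <= 1),
          1 - eps < h x &
          forall y, (choquet_boundary `\` U) y -> h y < eps].

End VectorFunctionSpaces.

(* [T] is a surjective linear isomorphism from [H1] onto [H2] with inverse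
   [S], both bounded for the supremum norms. *)
Definition isomorphism_pair (R : realType) (K1 K2 : topologicalType)
    (E1 E2 : completeNormedModType R) (H1 : set (K1 -> E1))
    (H2 : set (K2 -> E2)) (T : H1 -> H2) (S : H2 -> H1) :=
  [/\ cancel T S, cancel S T,
      linear_on (fun h => set_val (T h)),
      bounded_on (@supnorm R K1 E1) (@supnorm R K2 E2)
        (fun h => set_val (T h)) &
      bounded_on (@supnorm R K2 E2) (@supnorm R K1 E1)
        (fun h => set_val (S h))].

(* The operator norm of [T : H1 -> H2] for the supremum norms. *)
Definition function_opnorm (R : realType) (K1 K2 : topologicalType)
    (E1 E2 : completeNormedModType R) (H1 : set (K1 -> E1))
    (H2 : set (K2 -> E2)) (T : H1 -> H2) : R :=
  opnorm (@supnorm R K1 E1) (@supnorm R K2 E2) (fun h => set_val (T h)).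

(* Main.v *)
Require Import Defs.
From HB Require Import structures.
From mathcomp Require Import all_boot all_order all_algebra.
From mathcomp Require Import all_classical all_reals all_analysis.
From mathcomp Require Import lra ring.
From mathcomp Require wochoice.

(** Let [X] and [Y] be the two Choquet boundaries.  The norm of a function of
    [H1] or [H2] is determined by its values on the Choquet boundary, because an
    extreme point of the dual ball of the canonical scalar space is, up to
    sign, an evaluation; so [T] may be read as a map from functions on [X] to
    functions on [Y].

    The point where the constant 3 enters is the following.  Let [c] have norm
    about 1 and be close to a unit vector [e] near a point of the [i]-th
    Cantor-Bendixson derivative of [X], and suppose that [T c] is small on the
    [i]-th derivative of [Y].  Since [E2] contains no copy of c0, a function of
    a disjoint sequence [h_n e] of peak functions has an image which is small
    at finitely many given points when [n] is large; by well-founded induction on [i], one gets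
    functions [v_1], ..., [v_k], close to [e] on smaller and smaller sets, such
    that at every point of [Y] the image of [c] or of some [v_j] is small.  If
    [w] is a peak function (times [e]) concentrated where all of these are close
    to [e], then [c + 2 w] has norm about 3, while [c + 2 w - 2 v] has norm about
    1 for each [v] among [c], [v_1], ..., [v_k].  Hence [T (c + 2 w)] has norm
    about [||T||] at most, and [||T|| ||T^-1||] is at least 3.

    So [T c] cannot be small on the [i]-th derivative of [Y].  If the latter is
    finite with [m] points and the [i]-th derivative of [X] has [n] points, this
    gives a copy of [E1^n] in [E2^m], whence [n <= m].  Consequently, [X] and [Y]
    have the same height and the same number of points in the last nonempty
    derivative, and they are homeomorphic by the theorem of Mazurkiewicz and
    Sierpinski, which is proved by a back-and-forth argument on clopen sets. *)

Set Implicit Arguments.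
Unset Strict Implicit.
Unset Printing Implicit Defensive.

Import Order.TTheory GRing.Theory Num.Theory.
Import numFieldNormedType.Exports.

Local Open Scope classical_set_scope.
Local Open Scope ring_scope.

(** * Sublinear functionals and extreme linear forms *)

Section SublinearForms.
Context {R : realType}.
Implicit Types (V : lmodType R).

Definition subspace_set V (D : set V) :=
  D 0 /\ forall (a : R) u v, D u -> D v -> D (a *: u + v).

Definition form_on V (D : set V) (phi : V -> R) :=
  forall (a : R) u v, D u -> D v -> phi (a *: u + v) = a * phi u + phi v.

Definition sublinear_on V (D : set V) (p : V -> R) :=
  (forall u v, D u -> D v -> p (u + v) <= p u + p v) /\
  (forall (a : R) u, 0 <= a -> D u -> p (a *: u) <= a * p u).

Definition below V (D : set V) (q p : V -> R) := forall u, D u -> q u <= p u.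

Lemma subspaceZ V (D : set V) a u : subspace_set D -> D u -> D (a *: u).
Proof. by move=> [D0 DL] Du; rewrite -[_ *: _]addr0; exact: DL. Qed.

Lemma subspaceD V (D : set V) u v : subspace_set D -> D u -> D v -> D (u + v).
Proof. by move=> [_ DL] Du Dv; rewrite -[u]scale1r; exact: DL. Qed.

Lemma subspaceN V (D : set V) u : subspace_set D -> D u -> D (- u).
Proof. by move=> DD Du; rewrite -scaleN1r; exact: subspaceZ. Qed.

Lemma subspaceB V (D : set V) u v : subspace_set D -> D u -> D v -> D (u - v).
Proof. by move=> DD Du Dv; apply: subspaceD => //; exact: subspaceN. Qed.

Lemma form_on0 V (D : set V) phi : subspace_set D -> form_on D phi -> phi 0 = 0.
Proof. by move=> [D0 _] /(_ (-1) 0 0 D0 D0); rewrite scaleN1r addNr; lra. Qed.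

Lemma form_onZ V (D : set V) phi a u : subspace_set D -> form_on D phi -> D u ->
  phi (a *: u) = a * phi u.
Proof.
move=> DD pL Du; have := pL a u 0 Du DD.1.
by rewrite addr0 (form_on0 DD pL) addr0.
Qed.

Lemma form_onD V (D : set V) phi u v : form_on D phi -> D u -> D v ->
  phi (u + v) = phi u + phi v.
Proof. by move=> pL Du Dv; have := pL 1 u v Du Dv; rewrite scale1r mul1r. Qed.

Lemma form_onN V (D : set V) phi u : subspace_set D -> form_on D phi -> D u ->
  phi (- u) = - phi u.
Proof. by move=> DD pL Du; rewrite -scaleN1r (form_onZ _ DD pL Du) mulN1r. Qed.

Lemma form_onB V (D : set V) phi u v : subspace_set D -> form_on D phi ->
  D u -> D v -> phi (u - v) = phi u - phi v.
Proof.
move=> DD pL Du Dv; rewrite (form_onD pL) ?(form_onN DD pL)//.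
exact: subspaceN.
Qed.

Lemma form_on_le_eq V (D : set V) phi psi : subspace_set D ->
  form_on D phi -> form_on D psi -> below D phi psi ->
  forall u, D u -> phi u = psi u.
Proof.
move=> DD pL sL le u Du; have := le _ (subspaceN DD Du).
by rewrite (form_onN DD pL)// (form_onN DD sL)//; have := le _ Du; lra.
Qed.

Lemma le_inf_add (E F : set R) z : E !=set0 -> F !=set0 ->
  (forall x y, E x -> F y -> z <= x + y) -> z <= inf E + inf F.
Proof.
move=> E0 F0 zEF; rewrite -lerBlDl; apply: lb_le_inf => // y Fy.
rewrite lerBlDr -lerBlDl; apply: lb_le_inf => // x Ex.
by rewrite lerBlDl addrC; have := zEF _ _ Ex Fy; lra.
Qed.

Section Sublinear.
Variables (V : lmodType R) (D : set V).
Hypothesis DD : subspace_set D.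

Lemma sublinear0 p : sublinear_on D p -> p 0 = 0.
Proof.
move=> [pD pZ]; have D0 := DD.1.
have := pZ 0 0 (lexx _) D0; have := pD 0 0 D0 D0.
by rewrite scaler0 addr0; lra.
Qed.

Lemma sublinearN p u : sublinear_on D p -> D u -> - p (- u) <= p u.
Proof.
move=> sp Du; have := sp.1 _ _ Du (subspaceN DD Du).
by rewrite subrr (sublinear0 sp); lra.
Qed.

(** Oddness reverses subadditivity: [v] is the sum of [a *: u + v] and [- (a *: u)], so [p v] is at
    most [p (a *: u + v) - p (a *: u)]. *)
Lemma sublinear_odd p : sublinear_on D p ->
  (forall u, D u -> p (- u) <= - p u) -> form_on D p.
Proof.
move=> sp pN.
have pZ a u : 0 <= a -> D u -> p (a *: u) = a * p u.
  move=> a0 Du; apply/eqP; rewrite eq_le sp.2//=.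
  have := sublinearN sp (subspaceZ a DD Du).
  rewrite -scalerN; have := sp.2 a (- u) a0 (subspaceN DD Du).
  have := pN _ Du; nra.
have pN' u : D u -> p (- u) = - p u.
  by move=> Du; have := pN _ Du; have := sublinearN sp Du; lra.
move=> a u v Du Dv; have {}pZ : p (a *: u) = a * p u.
  have [a0|a0] := leP 0 a; first exact: pZ.
  rewrite -[a *: u]opprK -scaleNr pN'; last exact: subspaceZ.
  by rewrite pZ ?mulNr ?opprK//; lra.
have Dau := subspaceZ a DD Du.
have := sp.1 _ _ Dau Dv; have := sp.1 _ _ (subspaceD DD Dau Dv) (subspaceN DD Dau).
by rewrite addrAC subrr add0r pN'//; lra.
Qed.

(* the value at [g] of the largest sublinear functional below [q] all of whose
   linear minorants take the value [q f] at [f] *)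
Definition peel (q : V -> R) f g :=
  inf [set q (g + t *: f) - t * q f | t in [set t : R | 0 <= t]].

Section Peel.
Variables (q : V -> R) (f : V).
Hypotheses (sq : sublinear_on D q) (Df : D f).

Lemma peel_le g t : 0 <= t -> D g -> peel q f g <= q (g + t *: f) - t * q f.
Proof.
move=> t0 Dg; apply: ge_inf; last by exists t.
exists (- q (- g)) => _ [s /= s0 <-].
have Dsf := subspaceZ s DD Df.
have := sq.1 _ _ (subspaceD DD Dg Dsf) (subspaceN DD Dg).
rewrite addrAC subrr add0r => h.
(* [sublinear_on] bounds [q (s *: f)] only from above; the lower bound comes from rescaling by
   [s^-1]. *)
suff h' : s * q f <= q (s *: f).
  by move: h h'; lra.
have [->|s1] := eqVneq s 0; first by rewrite scale0r mul0r (sublinear0 sq).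
have sp : 0 < s by rewrite lt_neqAle eq_sym s1.
have := sq.2 s^-1 _ _ Dsf; rewrite scalerA mulVf// scale1r invr_ge0 => /(_ s0).
by rewrite -(ler_pM2l sp) mulrA mulfV// mul1r.
Qed.

Lemma le_peel z g : (forall t, 0 <= t -> z <= q (g + t *: f) - t * q f) ->
  z <= peel q f g.
Proof.
move=> zle; apply: lb_le_inf; first by exists (q (g + 0 *: f) - 0 * q f); exists 0 => //=.
by move=> _ [t /= t0 <-]; exact: zle.
Qed.

Lemma peel_below : below D (peel q f) q.
Proof.
by move=> g Dg; have := peel_le (lexx 0) Dg; rewrite scale0r addr0 mul0r subr0.
Qed.

Lemma peelN : peel q f (- f) <= - q f.
Proof.
have := peel_le ler01 (subspaceN DD Df).
by rewrite scale1r addNr (sublinear0 sq) mul1r sub0r.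
Qed.

Lemma peel_sublinear : sublinear_on D (peel q f).
Proof.
split=> [u v Du Dv|a u a0 Du].
  apply: le_inf_add; [| |move=> _ _ [t /= t0 <-] [s /= s0 <-]].
  - by exists (q (u + 0 *: f) - 0 * q f); exists 0 => //=.
  - by exists (q (v + 0 *: f) - 0 * q f); exists 0 => //=.
  have := peel_le (addr_ge0 t0 s0) (subspaceD DD Du Dv).
  rewrite scalerDl addrACA.
  have := sq.1 _ _ (subspaceD DD Du (subspaceZ t DD Df))
    (subspaceD DD Dv (subspaceZ s DD Df)).
  by rewrite mulrDl; lra.
have [->|an0] := eqVneq a 0.
  have := peel_below (subspaceZ 0 DD Du).
  by rewrite scale0r (sublinear0 sq) mul0r.
have ap : 0 < a by rewrite lt_neqAle eq_sym an0.
rewrite mulrC -ler_pdivrMr//; apply: le_peel => t t0.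
have := peel_le (mulr_ge0 a0 t0) (subspaceZ a DD Du).
rewrite -scalerA -scalerDr ler_pdivrMr//.
have := sq.2 a _ a0 (subspaceD DD Du (subspaceZ t DD Df)).
by rewrite mulrBl -mulrA; nra.
Qed.

End Peel.

Definition convex_form t (phi psi : V -> R) u := t * phi u + (1 - t) * psi u.

(* the linear minorants of [q] form a face of the set of those of [p] *)
Definition face_of (p q : V -> R) :=
  [/\ sublinear_on D q, below D q p &
   forall phi psi t, form_on D phi -> form_on D psi -> below D phi p ->
     below D psi p -> 0 < t < 1 -> below D (convex_form t phi psi) q ->
     below D phi q /\ below D psi q].

Lemma face_of_refl p : sublinear_on D p -> face_of p p.
Proof. by move=> sp; split. Qed.

(** At [f] both forms are at most [q f], while the bound at [- f] forces their convex combination to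
    be at least [q f]. Hence both equal [q f] there, which puts them below [peel q f]. *)
Lemma face_of_peel p q f : D f -> face_of p q -> face_of p (peel q f).
Proof.
move=> Df [sq qp face]; split; first exact: peel_sublinear.
  by move=> u Du; apply: le_trans (qp _ Du); exact: peel_below.
move=> phi psi t phiL psiL phip psip t01 cq.
have [phiq psiq] : below D phi q /\ below D psi q.
  apply: face psip t01 _ => // u Du.
  by apply: le_trans (cq _ Du) _; exact: peel_below.
have qf : q f <= convex_form t phi psi f.
  have := le_trans (cq _ (subspaceN DD Df)) (peelN sq Df).
  rewrite /convex_form (form_onN DD phiL)// (form_onN DD psiL)//; lra.
have {qf} [phif psif] : phi f = q f /\ psi f = q f.
  have := phiq _ Df; have := psiq _ Df; move: qf; rewrite /convex_form.
  by move/andP: t01 => [t0 t1]; split; nra.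
have aux chi : form_on D chi -> below D chi q -> chi f = q f ->
    below D chi (peel q f).
  move=> chiL chiq chif u Du; apply: le_peel => s s0.
  have Dsf := subspaceZ s DD Df.
  have := chiq _ (subspaceD DD Du Dsf).
  by rewrite (form_onD chiL)// (form_onZ _ DD chiL)// chif; lra.
by split; exact: aux.
Qed.

(** Zorn's lemma. A chain is bounded by its pointwise infimum, finite because every member is at
    least [- p (- u)] at [u]. For subadditivity, of two members of the chain the smaller one is used
    at both vectors. *)
Lemma minimal_face p q0 : sublinear_on D p -> face_of p q0 ->
  exists q, [/\ face_of p q, below D q q0 &
    forall q', face_of p q' -> below D q' q -> below D q q'].
Proof.
move=> sp fq0.
pose T := {q : V -> R | face_of p q /\ below D q q0}.
pose r (q q' : T) := `[< below D (sval q') (sval q) >].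
have t0 : T by exists q0; split.
have [||A Atot|q qmin] := @ZL_preorder T t0 r.
- by move=> q; apply/asboolP => u Du.
- move=> q1 q2 q3 /asboolP h1 /asboolP h2; apply/asboolP => u Du.
  by apply: le_trans (h2 _ Du) _; exact: h1.
- have [[a Aa]|A0] := pselect (A !=set0); last first.
    by exists t0 => s As; exfalso; apply: A0; exists s.
  pose q u := inf [set sval s u | s in A].
  have qle s u : A s -> D u -> q u <= sval s u.
    move=> As Du; apply: ge_inf; last by exists s.
    exists (- p (- u)) => _ [s' As' <-].
    have [[sq qp _] _] := svalP s'.
    apply: le_trans (sublinearN sq Du); rewrite lerN2.
    by apply: qp; exact: subspaceN.
  have leq z u : (forall s, A s -> z <= sval s u) -> z <= q u.
    move=> h; apply: lb_le_inf; first by exists (sval a u); exists a => //=.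
    by move=> _ [s As <-]; exact: h.
  have fq : face_of p q.
    split.
    + split=> [u v Du Dv|b u b0 Du].
        apply: le_inf_add => [| |_ _ [s As <-] [s' As' <-]].
        * by exists (sval a u); exists a => //=.
        * by exists (sval a v); exists a => //=.
        have Duv := subspaceD DD Du Dv.
        have [/asboolP h|/asboolP h] := Atot _ _ As As'.
          have [[sq _ _] _] := svalP s'.
          by have := qle _ _ As' Duv; have := sq.1 _ _ Du Dv; have := h _ Du; lra.
        have [[sq _ _] _] := svalP s.
        by have := qle _ _ As Duv; have := sq.1 _ _ Du Dv; have := h _ Dv; lra.
      have Dbu := subspaceZ b DD Du.
      have [bn0|bn0] := eqVneq b 0.
        apply: le_trans (qle a _ Aa Dbu) _.
        have [[sq _ _] _] := svalP a.
        by rewrite bn0 scale0r (sublinear0 sq) mul0r.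
      have bp : 0 < b by rewrite lt_neqAle eq_sym bn0.
      rewrite mulrC -ler_pdivrMr//; apply: leq => s As.
      rewrite ler_pdivrMr// mulrC; have [[sq _ _] _] := svalP s.
      by apply: le_trans (sq.2 _ _ b0 Du); exact: qle.
    + move=> u Du; apply: le_trans (qle a _ Aa Du) _.
      by have [[_ ap _] _] := svalP a; exact: ap.
    + move=> phi psi t phiL psiL phip psip t01 cq.
      have aux s : A s -> below D phi (sval s) /\ below D psi (sval s).
        move=> As; have [[_ _ face] _] := svalP s.
        apply: face psip t01 _ => // u Du.
        by apply: le_trans (cq _ Du) _; exact: qle.
      split=> u Du; apply: leq => s As.
        by have [h _] := aux _ As; exact: h.
      by have [_ h] := aux _ As; exact: h.
  have qq0 : below D q q0.
    move=> u Du; apply: le_trans (qle a _ Aa Du) _.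
    by have [_ aq] := svalP a; exact: aq.
  exists (exist _ q (conj fq qq0)) => s As; apply/asboolP => u Du.
  exact: qle.
- have [fq qq0] := svalP q; exists (sval q); split=> // q' fq' q'q.
  have q'q0 : below D q' q0.
    by move=> u Du; apply: le_trans (q'q _ Du) _; exact: qq0.
  by apply/asboolP; apply: (qmin (exist _ q' (conj fq' q'q0))); exact/asboolP.
Qed.

(** A Krein-Milman argument: the peel at [f] fixes the value [p f], a minimal face inside it lies
    below all of its own peels and is therefore odd, hence linear, and a face with a single linear
    form is an extreme point. *)
Lemma extreme_form p f : sublinear_on D p -> D f ->
  exists phi, [/\ form_on D phi, below D phi p, phi f = p f &
    forall phi1 phi2 t, form_on D phi1 -> form_on D phi2 ->
      below D phi1 p -> below D phi2 p -> 0 < t < 1 ->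
      (forall u, D u -> phi u = convex_form t phi1 phi2 u) ->
      forall u, D u -> phi1 u = phi u /\ phi2 u = phi u].
Proof.
move=> sp Df.
have [q [fq qpf qmin]] :=
  minimal_face sp (face_of_peel Df (face_of_refl sp)).
have [sq qp face] := fq.
have qL : form_on D q.
  apply: sublinear_odd => // u Du.
  have := qmin _ (face_of_peel Du fq) (peel_below sq Du).
  by move/(_ _ (subspaceN DD Du))/le_trans; apply; exact: peelN.
exists q; split=> //.
  apply/eqP; rewrite eq_le qp//=.
  have := le_trans (qpf _ (subspaceN DD Df)) (peelN sp Df).
  by rewrite (form_onN DD qL)//; lra.
move=> phi1 phi2 t L1 L2 p1 p2 t01 qE u Du.
have [h1 h2] : below D phi1 q /\ below D phi2 q.
  by apply: face p2 t01 _ => // v Dv; rewrite qE.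
by split; apply: (form_on_le_eq DD).
Qed.

End Sublinear.
End SublinearForms.

(** * The Hahn-Banach theorem and norming functionals *)

Section HahnBanach.
Context {R : realType}.

(** [p'] is the infimal convolution of [p] and [phi]. It is sublinear, below [p], and at most [phi]
    on [D], so each of its linear minorants extends [phi]. *)
Lemma extend_form (V : lmodType R) (D B : set V) (p phi : V -> R) :
  subspace_set D -> subspace_set B -> D `<=` B -> sublinear_on B p ->
  form_on D phi -> below D phi p ->
  exists Phi, [/\ form_on B Phi, below B Phi p & forall u, D u -> Phi u = phi u].
Proof.
move=> DD BB DB sp phiL phip.
pose p' g := inf [set p (g - a) + phi a | a in D].
have p'le g a : B g -> D a -> p' g <= p (g - a) + phi a.
  move=> Bg Da; apply: ge_inf; last by exists a.
  exists (- p (- g)) => _ [b Db <-].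
  have Bgb : B (g - b) by apply: subspaceB => //; exact: DB.
  have := sp.1 _ _ Bgb (subspaceN BB Bg).
  rewrite addrAC subrr add0r.
  have := phip _ (subspaceN DD Db); rewrite (form_onN DD phiL)//.
  by move=> h1 h2; lra.
have lep' z g : (forall a, D a -> z <= p (g - a) + phi a) -> z <= p' g.
  move=> h; apply: lb_le_inf.
    by exists (p (g - 0) + phi 0); exists 0 => //; exact: DD.1.
  by move=> _ [a Da <-]; exact: h.
have ne g : [set p (g - a) + phi a | a in D] !=set0.
  by exists (p (g - 0) + phi 0); exists 0 => //; exact: DD.1.
have sp' : sublinear_on B p'.
  split=> [u v Bu Bv|b u b0 Bu].
    apply: le_inf_add => // _ _ [a Da <-] [c Dc <-].
    have := p'le _ _ (subspaceD BB Bu Bv) (subspaceD DD Da Dc).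
    rewrite (form_onD phiL)// opprD addrACA.
    have := sp.1 _ _ (subspaceB BB Bu (DB _ Da)) (subspaceB BB Bv (DB _ Dc)).
    lra.
  have [bn0|bn0] := eqVneq b 0.
    have := p'le _ _ (subspaceZ b BB Bu) DD.1.
    by rewrite bn0 scale0r subr0 (sublinear0 BB sp) (form_on0 DD phiL) mul0r addr0.
  have bp : 0 < b by rewrite lt_neqAle eq_sym bn0.
  rewrite mulrC -ler_pdivrMr//; apply: lep' => a Da.
  have := p'le _ _ (subspaceZ b BB Bu) (subspaceZ b DD Da).
  rewrite -scalerBr (form_onZ _ DD phiL)// ler_pdivrMr//.
  by have := sp.2 b _ b0 (subspaceB BB Bu (DB _ Da)); lra.
have [Phi [PhiL Phip' _ _]] := extreme_form BB sp' BB.1.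
exists Phi; split=> // [u Bu|u Du].
  apply: le_trans (Phip' _ Bu) _.
  have := p'le _ _ Bu DD.1.
  by rewrite subr0 (form_on0 DD phiL) addr0.
suff : forall u, D u -> Phi u = phi u by exact.
apply: (form_on_le_eq DD) => // [a v w Dv Dw|v Dv].
  by apply: PhiL; exact: DB.
apply: le_trans (Phip' _ (DB _ Dv)) _.
have := p'le _ _ (DB _ Dv) Dv.
by rewrite subrr (sublinear0 BB sp) add0r.
Qed.

Lemma subspace_setT (V : lmodType R) : subspace_set [set: V].
Proof. by []. Qed.

Lemma norm_sublinear (E : normedModType R) :
  sublinear_on [set: E] (fun u : E => `|u|).
Proof.
split=> [u v _ _|a u a0 _]; first exact: ler_normD.
by rewrite normrZ ger0_norm.
Qed.

Lemma norming_form (E : normedModType R) (e : E) :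
  exists phi : {scalar E}, [/\ forall u, `|phi u| <= `|u|, phi e = `|e| &
    continuous (phi : E -> R^o)].
Proof.
have [phi [phiL phip phie _]] :=
  extreme_form (subspace_setT E) (norm_sublinear E) (I : [set: E] e).
have philin : scalar phi by move=> a u v; exact: phiL.
pose f : {scalar E} := HB.pack phi (GRing.isLinear.Build _ _ _ _ phi philin).
have fn u : `|f u| <= `|u|.
  rewrite ler_norml phip// andbT lerNl -normrN.
  by rewrite -(form_onN (subspace_setT E) phiL)//; exact: phip.
exists f; split=> //.
move=> x; apply/cvgrPdist_le => /= eps eps0; near=> t.
have -> : f x - f t = f (x - t) by rewrite raddfB.
apply: le_trans (fn _) _.
near: t; move/cvgrPdist_le: (@cvg_id _ (nbhs x)); exact.
Unshelve. all: by end_near. Qed.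

End HahnBanach.

(** * The sup norm on bounded functions *)

Section Supnorm.
Context {R : realType} {X : Type} {E : normedModType R}.
Implicit Types f : X -> E.

Definition bounded_funs : set (X -> E) :=
  [set f | exists M : R, forall x, `|f x| <= M].

Lemma supnorm_le f M : 0 <= M -> (forall x, `|f x| <= M) -> supnorm f <= M.
Proof.
move=> M0 fM; rewrite /supnorm.
have [[x]|X0] := pselect (inhabited X).
  apply: ge_sup; first by exists `|f x|, x.
  by move=> _ [y _ <-].
rewrite (_ : [set _ | _ in _] = set0) ?sup0//.
by apply/seteqP; split=> // z [x _ _]; apply: X0.
Qed.

Lemma le_supnorm f x : bounded_funs f -> `|f x| <= supnorm f.
Proof.
move=> [M fM]; apply: ub_le_sup; last by exists x.
by exists M => _ [y _ <-].
Qed.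

Lemma supnorm_ge0 f : 0 <= supnorm f.
Proof.
rewrite /supnorm; set S := [set _ | _ in _].
have [hS|hS] := pselect (has_sup S); last by rewrite sup_out.
have [[z [x _ _]] ubS] := hS.
by apply: le_trans (normr_ge0 (f x)) _; apply: ub_le_sup => //; exists x.
Qed.

Lemma bounded_funs_subspace : subspace_set bounded_funs.
Proof.
split; first by exists 0 => x; rewrite normr0.
move=> a u v [M uM] [N vN]; exists (`|a| * M + N) => x.
apply: le_trans (ler_normD _ _) _; rewrite normrZ lerD//.
by rewrite ler_wpM2l.
Qed.

Lemma supnorm_sublinear : sublinear_on bounded_funs (@supnorm R X E).
Proof.
split=> [u v bu bv|a u a0 bu].
  apply: supnorm_le; first by rewrite addr_ge0 ?supnorm_ge0.
  move=> x; apply: le_trans (ler_normD _ _) _.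
  by rewrite lerD ?le_supnorm.
apply: supnorm_le; first by rewrite mulr_ge0 ?supnorm_ge0.
move=> x; rewrite normrZ ger0_norm// ler_wpM2l//; exact: le_supnorm.
Qed.

End Supnorm.
Arguments bounded_funs {R} X E.

(** * The Choquet boundary is norming *)

Section ExtremeEvaluation.
Context {R : realType} {K : topologicalType}.
Hypothesis K_compact : compact [set: K].
Variable A : set (K -> R^o).
Hypotheses (AA : subspace_set A) (A_cont : A `<=` [set h | continuous h])
  (A_bnd : A `<=` bounded_funs K R^o).

Local Notation V := (K -> R^o).
Local Notation nrm := (@supnorm R K R^o).
Local Notation Bd := (bounded_funs K R^o).

(** Extremality in the dual ball, for functions on the whole module that are linear on [A]. For such
    a form, being below [nrm] means having norm at most 1, as [A] and [nrm] are symmetric. *)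
Definition extreme_in_ball (phi : V -> R) :=
  forall phi1 phi2 t, form_on A phi1 -> form_on A phi2 ->
    below A phi1 nrm -> below A phi2 nrm -> 0 < t < 1 ->
    (forall u, A u -> phi u = convex_form t phi1 phi2 u) ->
    forall u, A u -> phi1 u = phi u /\ phi2 u = phi u.

(** Cutting destroys continuity, which is why [phi] is extended to a form [Phi] on all bounded
    functions. *)
Definition cut (S : set K) (g : V) : V := fun x => if x \in S then g x else 0.

Lemma cut_lin S a g h : cut S (a *: g + h) = a *: cut S g + cut S h.
Proof.
apply/funext => x; rewrite /cut !fctE; case: ifP => //.
by rewrite scaler0 addr0.
Qed.

Lemma cut_bounded S g : Bd g -> Bd (cut S g).
Proof.
move=> [M gM]; exists M => x; rewrite /cut; case: ifP => // _.
by rewrite normr0; apply: le_trans (gM x).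
Qed.

Lemma cutC S g : cut S g + cut (~` S) g = g.
Proof.
apply/funext => x; rewrite /cut !fctE in_setC.
by case: (x \in S); rewrite ?addr0 ?add0r.
Qed.

Section Splitting.
Variables (phi Phi : V -> R).
Hypotheses (PhiL : form_on Bd Phi) (Phin : below Bd Phi nrm)
  (phiE : forall u, A u -> Phi u = phi u) (phi_ext : extreme_in_ball phi)
  (phi_neq0 : exists2 a, A a & phi a != 0).

Let BB : subspace_set Bd := bounded_funs_subspace.

(** The total variation on [S] of the finitely additive measure represented by [Phi]. *)
Let mass S := sup [set Phi (cut S g) | g in [set g : V | forall x, `|g x| <= 1]].

Let Phi_le g M : 0 <= M -> (forall x, `|g x| <= M) -> Phi g <= M.
Proof.
move=> M0 gM; apply: le_trans (Phin _) _; first by exists M.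
exact: supnorm_le.
Qed.

Let mass_ub S g : (forall x, `|g x| <= 1) -> Phi (cut S g) <= mass S.
Proof.
move=> g1; apply: ub_le_sup; last by exists g.
exists 1 => _ [h h1 <-]; apply: Phi_le => // x.
by rewrite /cut; case: ifP => // _; rewrite normr0.
Qed.

Let cut0 S : cut S 0 = 0.
Proof. by apply/funext => x; rewrite /cut if_same. Qed.

Let mass_ge0 S : 0 <= mass S.
Proof.
have := @mass_ub S 0; rewrite cut0 (form_on0 BB PhiL); apply => x.
by rewrite normr0.
Qed.

Let cutZ S a g : cut S (a *: g) = a *: cut S g.
Proof. by have := cut_lin S a g 0; rewrite cut0 !addr0. Qed.

Let Phi_cutL S : form_on Bd (Phi \o cut S).
Proof.
by move=> a u v Bu Bv /=; rewrite cut_lin PhiL//; exact: cut_bounded.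
Qed.

Let mass_le S g M : 0 <= M -> (forall x, `|g x| <= M) ->
  Phi (cut S g) <= M * mass S.
Proof.
move=> M0 gM; have Bg : Bd g by exists M.
have [M1|M1] := eqVneq M 0.
  have -> : g = 0.
    apply/funext => x; apply/eqP; rewrite -normr_le0.
    by apply: le_trans (gM x) _; rewrite M1.
  by rewrite cut0 (form_on0 BB PhiL) mulr_ge0.
have Mp : 0 < M by rewrite lt_neqAle eq_sym M1.
have := @mass_ub S (M^-1 *: g); rewrite cutZ.
rewrite (form_onZ _ BB PhiL); last exact: cut_bounded.
rewrite ler_pdivrMl//; apply => x.
by rewrite fctE normrM ger0_norm ?invr_ge0// ler_pdivrMl// mulr1.
Qed.

Let mass_norm S g M : 0 <= M -> (forall x, `|g x| <= M) ->
  `|Phi (cut S g)| <= M * mass S.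
Proof.
move=> M0 gM; have Bg : Bd g by exists M.
rewrite ler_norml mass_le// andbT lerNl.
rewrite -(form_onN BB PhiL); last exact: cut_bounded.
have -> : - cut S g = cut S (- g) by rewrite -(scaleN1r g) cutZ scaleN1r.
by apply: mass_le => // x; rewrite fctE normrN.
Qed.

Let mass_add S : mass S + mass (~` S) <= 1.
Proof.
have ne T : [set Phi (cut T g) | g in [set g : V | forall x, `|g x| <= 1]] !=set0.
  by exists (Phi (cut T 0)); exists 0 => //= x; rewrite normr0.
rewrite -lerBrDr; apply: ge_sup => // _ [g g1 <-].
rewrite lerBrDr -lerBrDl; apply: ge_sup => // _ [h h1 <-].
rewrite lerBrDl -(form_onD PhiL).
- apply: Phi_le => // x; rewrite fctE /cut in_setC.
  by case: (x \in S); rewrite ?addr0 ?add0r.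
- by apply: cut_bounded; exists 1.
- by apply: cut_bounded; exists 1.
Qed.

(** Unless [S] has mass 0 or 1, the rescaled pieces of [Phi] on and off [S] write [phi] as a convex
    combination of forms in the ball; extremality makes each of them equal to [phi] on [A]. *)
Let massE S a : A a -> Phi (cut S a) = mass S * phi a.
Proof.
move=> Aa; have Ba := A_bnd Aa.
have [M aM] : exists M, 0 <= M /\ forall x, `|a x| <= M.
  have [M aM] := Ba; exists (Num.max M 0); split; first by rewrite le_max lexx orbT.
  by move=> x; rewrite le_max aM.
have m0 := mass_ge0 S; have m0' := mass_ge0 (~` S).
have split_a u : A u -> Phi (cut S u) + Phi (cut (~` S) u) = phi u.
  move=> Au; rewrite -(form_onD PhiL) ?cutC ?phiE//.
  - by apply: cut_bounded; exact: A_bnd.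
  - by apply: cut_bounded; exact: A_bnd.
have null T : mass T = 0 -> Phi (cut T a) = 0.
  move=> mT; apply/eqP; rewrite -normr_le0.
  by apply: le_trans (@mass_norm T a M aM.1 aM.2) _; rewrite mT mulr0.
have [mS|mS] := eqVneq (mass S) 0; first by rewrite null// mS mul0r.
have mp : 0 < mass S by rewrite lt_neqAle eq_sym mS.
have madd := mass_add S.
have [mS1|mS1] := eqVneq (mass S) 1.
  have mSC : mass (~` S) = 0 by move: mS1 madd m0'; lra.
  by have := split_a _ Aa; rewrite (null (~` S))// addr0 mS1 mul1r.
have m1 : mass S < 1 by rewrite lt_neqAle mS1/=; move: madd m0'; lra.
have t01 : 0 < mass S < 1 by rewrite mp.
pose phi1 u := (mass S)^-1 * Phi (cut S u).
(* Dividing by [1 - mass S] instead of the mass of the complement makes the coefficients add up to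
   1; [mass_add] still keeps [phi2] in the ball. *)
pose phi2 u := (1 - mass S)^-1 * Phi (cut (~` S) u).
have scaled T r : form_on A (fun u => r * Phi (cut T u)).
  move=> c u v Au Av; have := @Phi_cutL T c u v (A_bnd Au) (A_bnd Av).
  by move=> /= ->; rewrite mulrDr mulrCA.
have [u Au|u Au|u Au|] := phi_ext (scaled S (mass S)^-1)
  (scaled (~` S) (1 - mass S)^-1) _ _ t01 _ Aa.
- rewrite ler_pdivrMl// mulrC; apply: mass_le; first exact: supnorm_ge0.
  by move=> x; apply: le_supnorm; exact: A_bnd.
- rewrite ler_pdivrMl ?subr_gt0// mulrC.
  apply: le_trans (_ : _ <= nrm u * mass (~` S)) _.
    apply: mass_le; first exact: supnorm_ge0.
    by move=> x; apply: le_supnorm; exact: A_bnd.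
  rewrite ler_wpM2l ?supnorm_ge0//; move: madd; lra.
- rewrite /convex_form !mulrA mulfV// mulfV ?mul1r ?split_a//.
  by rewrite subr_eq0 eq_sym.
- by move=> <- _; rewrite mulrA mulfV// mul1r.
Qed.

(** Its cluster points form the support of [Phi]: a neighbourhood of mass 0 would have its
    complement in the filter. *)
Let null_filter : set_system K :=
  [set S | forall g, Bd g -> Phi (cut (~` S) g) = 0].

Let null_filter_proper : ProperFilter null_filter.
Proof.
split.
  move=> F0; have [a Aa /eqP] := phi_neq0; apply.
  rewrite -phiE// -(F0 a (A_bnd Aa)); congr Phi; apply/funext => x.
  by rewrite /cut in_setC in_set0.
split.
- move=> g Bg; rewrite -[RHS](form_on0 BB PhiL); congr Phi; apply/funext => x.
  by rewrite /cut in_setC in_setT.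
- move=> S T FS FT g Bg.
  have -> : cut (~` (S `&` T)) g = cut (~` S) g + cut (~` T) (cut S g).
    apply/funext => x; rewrite /cut !fctE !in_setC in_setI.
    by case: (x \in S); case: (x \in T); rewrite ?addr0 ?add0r.
  have BSg : Bd (cut S g) by exact: cut_bounded.
  rewrite (form_onD PhiL); [|exact: cut_bounded|exact: cut_bounded].
  by rewrite FS ?FT ?addr0.
- move=> S T ST FS g Bg.
  have -> : cut (~` T) g = cut (~` S) (cut (~` T) g).
    apply/funext => x; rewrite /cut !in_setC.
    by case: (boolP (x \in S)) => [/set_mem/ST/mem_set ->|].
  by apply: FS; exact: cut_bounded.
Qed.

(** Near a point [x] of the support, [a] is almost the constant [a x]. Comparing [massE] with the
    value of [Phi] on that constant, cut to a small neighbourhood [U], shows that [phi a] is close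
    to [a x * sU U]. *)
Lemma extreme_form_evaluation : exists (x : K) (s : R),
  (s = 1 \/ s = -1) /\ forall a, A a -> phi a = s * a x.
Proof.
have [x [_ clx]] : [set: K] `&` cluster null_filter !=set0.
  by apply: (@K_compact null_filter null_filter_proper); exact: (@filterT _ _ (@filter_filter _ _ null_filter_proper)).
have mass_gt0 U : nbhs x U -> 0 < mass U.
  move=> xU; rewrite lt_neqAle mass_ge0 andbT eq_sym; apply/eqP => mU.
  have /clx/(_ xU) [y []//] : null_filter (~` U).
  move=> g [M gM]; apply/eqP; rewrite setCK -normr_le0.
  have gM' y : `|g y| <= Num.max M 0 by rewrite le_max gM.
  apply: le_trans (mass_norm _ _ gM') _; first by rewrite le_max lexx orbT.
  by rewrite mU mulr0.
pose one : V := fun=> 1.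
have B1 : Bd one by exists 1 => y; rewrite normr1.
pose sU U := Phi (cut U one) / mass U.
have sU1 U : nbhs x U -> `|sU U| <= 1.
  move=> /mass_gt0 mU; rewrite normrM normfV (gtr0_norm mU) ler_pdivrMr//.
  by apply: mass_norm => // y; rewrite normr1.
have approx U a eps : nbhs x U -> A a -> 0 <= eps ->
    (forall y, U y -> `|a y - a x| <= eps) -> `|phi a - a x * sU U| <= eps.
  move=> xU Aa e0 aU; have mU := mass_gt0 _ xU.
  pose b : V := cut U (a - a x *: one).
  have bE : Phi (cut U b) = mass U * (phi a - a x * sU U).
    have -> : cut U b = cut U a - a x *: cut U one.
      apply/funext => y; rewrite /cut /b /one /cut !fctE.
      by case: (y \in U); rewrite ?scaler0 ?subr0.
    have Ba := A_bnd Aa.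
    rewrite (form_onB BB PhiL); last by apply: subspaceZ => //; exact: cut_bounded.
    rewrite (form_onZ _ BB PhiL); last exact: cut_bounded.
    rewrite (massE U Aa).
    by rewrite mulrBr /sU; congr (_ - _); rewrite [RHS]mulrCA; congr (_ * _);
       rewrite mulrC divfK ?gt_eqF.
    exact: cut_bounded.
  have := @mass_norm U b eps e0.
  rewrite bE normrM (gtr0_norm mU) [eps * _]mulrC ler_pM2l//; apply => y.
  rewrite /b /cut; case: ifPn => [/set_mem Uy|_]; last by rewrite normr0.
  by rewrite /one !fctE; rewrite /GRing.scale/= mulr1; exact: aU.
have near_x a eps : A a -> 0 < eps -> nbhs x [set y | `|a y - a x| <= eps].
  move=> Aa e0; have /(_ x)/cvgrPdist_le/(_ _ e0) := A_cont Aa.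
  by apply: filterS => y /=; rewrite distrC.
(* [sU U] may vary with [U], which depends on [a]. A neighbourhood that suits both [a] and some [b']
   with [b' x = 1] identifies the factor as [phi b']. *)
have [s [s1 phis]] : exists s, `|s| <= 1 /\ forall a, A a -> phi a = s * a x.
  have small : forall z : R, (forall e, 0 < e -> `|z| <= e) -> z = 0.
    move=> z h; apply/eqP; rewrite -normr_le0; apply/ler_addgt0Pl => e e0.
    by rewrite addr0; exact: h.
  have [[b Ab bx]|bx] := pselect (exists2 b, A b & b x != 0); last first.
    exists 0; split=> [|a Aa]; first by rewrite normr0.
    have ax : a x = 0 by apply/eqP/negPn/negP => ax; apply: bx; exists a.
    rewrite mul0r; apply: small => e e0.
    have := approx _ _ _ (near_x _ _ Aa e0) Aa (ltW e0).
    by rewrite ax mul0r subr0; apply.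
  pose b' : V := (b x)^-1 *: b.
  have Ab' : A b' by exact: subspaceZ.
  have b'x : b' x = 1 by rewrite /b' fctE /GRing.scale/= mulVf.
  have main a e : A a -> 0 < e -> exists r, [/\ `|r| <= 1,
      `|phi a - a x * r| <= e & `|phi b' - r| <= e].
    move=> Aa e0.
    pose U := [set y | `|a y - a x| <= e] `&` [set y | `|b' y - b' x| <= e].
    have xU : nbhs x U by apply: filterI; exact: near_x.
    exists (sU U); split; first exact: sU1.
      by apply: approx (ltW e0) _ => // y [].
    rewrite -[X in _ - X]mul1r -b'x.
    by apply: approx (ltW e0) _ => // y [].
  exists (phi b'); split.
    apply/ler_addgt0Pl => e e0; have [r [r1 _ br]] := main _ _ Ab' e0.
    have -> : phi b' = (phi b' - r) + r by rewrite subrK.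
    by apply: le_trans (ler_normD _ _) _; rewrite lerD.
  move=> a Aa; apply/eqP; rewrite -subr_eq0; apply/eqP; apply: small => e e0.
  have ap : 0 < 1 + `|a x| by rewrite ltr_wpDr.
  have [|r [_ ar br]] := main _ (e / (1 + `|a x|)) Aa; first by rewrite divr_gt0.
  have -> : phi a - phi b' * a x = (phi a - a x * r) - a x * (phi b' - r).
    by rewrite mulrBr; ring.
  apply: le_trans (ler_normB _ _) _; rewrite normrM.
  apply: le_trans (lerD ar (ler_wpM2l (normr_ge0 _) br)) _.
  by rewrite -[X in X + _]mul1r -mulrDl mulrC divfK ?gt_eqF.
exists x, s; split=> //.
have [c Ac phic] := phi_neq0.
have s0 : s != 0 by apply: contraNneq phic => s0; rewrite phis// s0 mul0r.
have [s_eq1|s_lt1] := eqVneq `|s| 1.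
  have [sp|sp] := leP 0 s; first by left; rewrite -s_eq1 ger0_norm.
  by right; rewrite -s_eq1 ltr0_norm// opprK.
(* Here [phi] is a proper convex combination of a signed evaluation and the zero form, so
   extremality would make it vanish. *)
have t01 : 0 < `|s| < 1 by rewrite normr_gt0 s0 lt_neqAle s_lt1.
exfalso; move/eqP: phic; apply.
have evL r : form_on A (fun a => r * a x).
  by move=> d u v _ _; rewrite !fctE mulrDr mulrCA.
have [u Au|u Au|u Au|_ <-] := phi_ext (evL (Num.sg s)) (evL 0) _ _ t01 _ Ac.
- apply: le_trans (ler_norm _) _; rewrite normrM normr_sg s0 mul1r.
  by apply: le_supnorm; exact: A_bnd.
- by rewrite mul0r supnorm_ge0.
- by rewrite /convex_form phis// mul0r mulr0 addr0 mulrA [`|s| * _]mulrC -numEsg.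
- by rewrite mul0r.
Qed.

End Splitting.
End ExtremeEvaluation.

(** * Uniform closure and boundedness of continuous functions *)

Section UniformClosure.
Context {R : realType} {K : topologicalType} {E : normedModType R}.

Lemma uniform_closureP (S : set (K -> E)) (f : K -> E) :
  closure (S : set {uniform K -> E}) f <->
  forall eps : R, 0 < eps -> exists2 g, S g & forall x, `|f x - g x| < eps.
Proof.
split=> [cSf eps eps0|h P /uniform_nbhs [U [entU UP]]].
  have [|g [Sg fg]] := cSf [set g | forall x, `|f x - g x| < eps].
    apply/uniform_nbhs; exists [set xy | ball xy.1 eps xy.2]; split.
      by rewrite -entourage_ballE; exists eps.
    by move=> g /= fg x; have := fg x I; rewrite /= -ball_normE.
  by exists g.
move: entU; rewrite -entourage_ballE => -[eps /= eps0 ballU].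
have [g Sg fg] := h _ eps0; exists g; split=> //.
apply: UP => x _; apply: ballU; rewrite /= -ball_normE; exact: fg.
Qed.

Lemma compact_bounded_funs (f : K -> E) : compact [set: K] -> continuous f ->
  bounded_funs K E f.
Proof.
move=> cK cf.
have /compact_bounded [M [_ fM]] : compact (f @` [set: K]).
  by apply: continuous_compact => //; exact: continuous_subspaceT.
exists (M + 1) => x; apply: (fM (M + 1)); first by rewrite ltrDl.
by exists x.
Qed.

End UniformClosure.

(** * The operator norm inequality on a subspace *)

Section OperatorNorm.
Context {R : realType} (V W : lmodType R) (D : set V) (nV : V -> R) (nW : W -> R).
Variable T : D -> W.
Hypotheses (DD : subspace_set D) (TL : linear_on T) (Tb : bounded_on nV nW T).
Hypotheses (nVZ : forall a u, D u -> nV (a *: u) = `|a| * nV u)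
  (nV0 : forall u, 0 <= nV u) (nW0 : forall w, 0 <= nW w)
  (nWZ : forall a u, nW (a *: T u) = `|a| * nW (T u)).

Definition set_elt (u : V) (Du : D u) : D := SigSub (mem_set Du).

Lemma linear_onP a u v (Du : D u) (Dv : D v) (Duv : D (a *: u + v)) :
  T (set_elt Duv) = a *: T (set_elt Du) + T (set_elt Dv).
Proof. exact: TL. Qed.

Lemma linear_on0 (D0 : D 0) : T (set_elt D0) = 0.
Proof.
have h : set_val (set_elt D0) = -1 *: set_val (set_elt D0) + set_val (set_elt D0).
  by rewrite set_valE/= scaler0 addr0.
by rewrite (TL h) scaleN1r addNr.
Qed.

Lemma linear_onZ a u (Du : D u) (Dau : D (a *: u)) :
  T (set_elt Dau) = a *: T (set_elt Du).
Proof.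
rewrite -[RHS]addr0 -(linear_on0 DD.1); apply: TL.
by rewrite set_valE/= addr0.
Qed.

Lemma bounded_on_opnorm (u : D) : nV (set_val u) <= 1 -> nW (T u) <= opnorm nV nW T.
Proof.
move=> u1; apply: ub_le_sup; last by exists u.
have [M TM] := Tb; exists `|M| => _ [v v1 <-]; apply: le_trans (TM v) _.
apply: le_trans (ler_wpM2r (nV0 _) (ler_norm M)) _.
by apply: ler_piMr.
Qed.

Lemma opnorm_ge0 : 0 <= opnorm nV nW T.
Proof.
apply: le_trans (bounded_on_opnorm (u := set_elt DD.1) _); first exact: nW0.
by rewrite set_valE/= -(scale0r 0) nVZ ?normr0 ?mul0r//; exact: DD.1.
Qed.

Lemma le_opnorm (u : D) : nW (T u) <= opnorm nV nW T * nV (set_val u).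
Proof.
case: u => u mu; have Du := set_mem mu.
have -> : exist _ u mu = set_elt Du :> D by exact: val_inj.
rewrite set_valE/=; have [u0|u0] := eqVneq (nV u) 0.
  have [M /(_ (set_elt Du))] := Tb; rewrite set_valE/= u0 !mulr0; exact.
have up : 0 < nV u by rewrite lt_neqAle eq_sym u0 nV0.
have Dcu := subspaceZ (nV u)^-1 DD Du.
have := bounded_on_opnorm (u := set_elt Dcu).
rewrite set_valE/= nVZ// (linear_onZ Du) nWZ gtr0_norm ?invr_gt0// mulVf//.
by rewrite ler_pdivrMl// mulrC; apply.
Qed.

End OperatorNorm.

Lemma supnormZ (R : realType) (X : Type) (E : normedModType R) (a : R) f :
  bounded_funs X E f -> supnorm (a *: f) = `|a| * supnorm f.
Proof.
have le (b : R) g : bounded_funs X E g -> supnorm (b *: g) <= `|b| * supnorm g.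
  move=> Bg; apply: supnorm_le; first by rewrite mulr_ge0 ?supnorm_ge0.
  by move=> x; rewrite normrZ ler_wpM2l// le_supnorm.
move=> Bf; apply/eqP; rewrite eq_le le//=.
have [->|a0] := eqVneq a 0; first by rewrite normr0 mul0r supnorm_ge0.
have := le a^-1 _ (subspaceZ a bounded_funs_subspace Bf).
rewrite scalerA mulVf// scale1r normfV ler_pdivlMl ?normr_gt0//.
Qed.

(** * The canonical scalar space and its Choquet boundary *)

Section Choquet.
Context {R : realType} {K : topologicalType} {E : completeNormedModType R}.
Hypothesis K_compact : compact [set: K].
Variable H : set (K -> E).
Hypothesis H_closed : closed_function_space H.

Local Notation A := (canonical_scalar_space H).
Local Notation nrm := (@supnorm R K R^o).
Local Notation gens := [set f : K -> R^o | exists2 e : {scalar E}, continuous e &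
  exists2 h, H h & f = e \o h].

Lemma function_space_subspace : subspace_set H.
Proof.
have [_ [H0 HL] _] := H_closed; split; first exact: set_mem H0.
move=> a u v Hu Hv; apply: set_mem; apply: HL; exact: mem_set.
Qed.

Lemma linear_span_subspace (V : lmodType R) (S : set V) :
  subspace_set (linear_span S).
Proof.
split.
  exists 0%N, (fun=> 0), (fun=> 0); split; first by case.
  by rewrite big_ord0.
move=> a _ _ [n [b [u [Su ->]]]] [m [c [v [Sv ->]]]].
exists (n + m)%N, (fun i : 'I_(n + m) => match fintype.split i with inl i => a * b i | inr j => c j end),
  (fun i : 'I_(n + m) => match fintype.split i with inl i => u i | inr j => v j end); split.
  by move=> i; case: (fintype.split i).
rewrite big_split_ord/= scaler_sumr; congr (_ + _); apply: eq_bigr => i _.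
  by rewrite (unsplitK (inl i)) scalerA.
by rewrite (unsplitK (inr i)).
Qed.

Lemma canonical_subspace : subspace_set A.
Proof.
have [S0 SL] := linear_span_subspace gens.
split; first by apply: subset_closure.
move=> a u v /uniform_closureP cu /uniform_closureP cv.
apply/uniform_closureP => eps eps0.
have e1 : 0 < eps / 2 / (1 + `|a|) by rewrite !divr_gt0// ltr_pwDl.
have [g Sg ug] := cu _ e1.
have e2 : 0 < eps / 2 by rewrite divr_gt0.
have [h Sh vh] := cv _ e2.
exists (a *: g + h); first exact: SL.
move=> x; rewrite !fctE.
have -> : a *: u x + v x - (a *: g x + h x) = a *: (u x - g x) + (v x - h x).
  by rewrite scalerBr opprD addrACA.
apply: le_lt_trans (ler_normD _ _) _; rewrite (splitr eps) ler_ltD//.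
rewrite normrZ; have := ltW (ug x); rewrite ler_pdivlMr ?ltr_pwDl// => {}ug.
apply: le_trans ug; rewrite mulrC ler_wpM2l// lerDr//.
Qed.

Lemma canonical_continuous : A `<=` [set h | continuous h].
Proof.
have span_cont g : linear_span gens g -> continuous g.
  move=> [n [a [u [Su ->]]]].
  apply: (big_ind (fun f : K -> R^o => continuous f)) => [|f h cf ch x|i _ x].
  - exact: cst_continuous.
  - exact: continuousD (cf x) (ch x).
  - apply: continuousZ; first exact: cst_continuous.
    have [e ce [h Hh ->]] := Su i.
    have [Hc _ _] := H_closed.
    by apply: continuous_comp; [exact: Hc|exact: ce].
move=> f /uniform_closureP cf x; apply/cvgrPdist_lt => /= eps eps0.
have e3 : 0 < eps / 3 by rewrite divr_gt0.
have [g /span_cont gc fg] := cf _ e3.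
have /cvgrPdist_lt/(_ _ e3) := gc x; apply: filterS => y gxy.
have -> : f x - f y = (f x - g x) + (g x - g y) - (f y - g y).
  by rewrite subrKA opprB subrKA.
apply: le_lt_trans (ler_normB _ _) _.
have := ler_normD (f x - g x) (g x - g y).
by have := fg x; have := fg y; lra.
Qed.

Lemma canonical_bounded : A `<=` bounded_funs K R^o.
Proof. by move=> f Af; apply: compact_bounded_funs => //; exact: canonical_continuous. Qed.

(** Translates functionals on the subtype of [A] into functions on the whole module, with value 0
    off [A], to which the results on sublinear functionals apply. *)
Lemma form_on_ball (phi : A -> R^o) : dual_ball nrm phi ->
  exists psi : (K -> R^o) -> R, [/\ form_on A psi, below A psi nrm &
    forall u : A, psi (val u) = phi u].
Proof.
move=> [phiL phib phi1].
pose psi u := if pselect (A u) is left Au then phi (set_elt Au) else 0.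
have psiE (u : A) : psi (val u) = phi u.
  rewrite /psi; case: pselect => [Au|]; last by move=> nA; case: nA; exact: set_valP.
  by congr phi; exact: val_inj.
exists psi; split=> //.
  move=> a u v Au Av; have Auv := canonical_subspace.2 a _ _ Au Av.
  rewrite (psiE (set_elt Auv)) (psiE (set_elt Au)) (psiE (set_elt Av)).
  exact: linear_onP.
move=> u Au; rewrite (psiE (set_elt Au)); apply: le_trans (ler_norm _) _.
have := @le_opnorm _ _ _ _ nrm (fun a : R^o => `|a|) phi canonical_subspace phiL phib.
have nZ a w : A w -> nrm (a *: w) = `|a| * nrm w.
  by move=> Aw; apply: supnormZ; exact: canonical_bounded.
move=> /(_ nZ (@supnorm_ge0 _ _ _) (fun a w => normrZ a (phi w)) (set_elt Au)).
move/le_trans; apply; rewrite set_valE/=.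
by apply: ler_piMl => //; exact: supnorm_ge0.
Qed.

Lemma evaluation_ball x : dual_ball (D := A) nrm (fun h => set_val h x).
Proof.
have ev (u : A) : `|set_val u x| <= nrm (set_val u).
  by apply: le_supnorm; apply: canonical_bounded; exact: set_valP.
split.
- by move=> a u v w ->.
- by exists 1 => u; rewrite mul1r.
- apply: ge_sup; last by move=> _ [u u1 <-]; apply: le_trans (ev u) _.
  exists `|set_val (set_elt canonical_subspace.1) x|, (set_elt canonical_subspace.1) => //=.
  by rewrite set_valE/=; apply: supnorm_le => // y; rewrite normr0.
Qed.

(** Multiplying a decomposition of the evaluation by [s] gives one of [phi]; [s * s = 1] undoes this
    at the end. *)
Lemma evaluation_choquet x s phi : (s = 1 \/ s = -1) ->
  extreme_in_ball A phi -> (forall a, A a -> phi a = s * a x) ->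
  choquet_boundary H x.
Proof.
move=> s1 phi_ext phiE; split; first exact: evaluation_ball.
move=> f g t fball gball t01 fg.
have [psi1 [L1 b1 E1]] := form_on_ball fball.
have [psi2 [L2 b2 E2]] := form_on_ball gball.
have AA := canonical_subspace.
have sL psi : form_on A psi -> form_on A (fun u => s * psi u).
  by move=> psiL a u v Au Av; rewrite psiL// mulrDr mulrCA.
have sb psi : form_on A psi -> below A psi nrm -> below A (fun u => s * psi u) nrm.
  move=> psiL psib u Au; case: s1 => ->; first by rewrite mul1r; exact: psib.
  rewrite mulN1r -(form_onN AA psiL)//.
  apply: le_trans (psib _ (subspaceN AA Au)) _.
  rewrite -scaleN1r supnormZ ?normrN1 ?mul1r//; exact: canonical_bounded.
have ss : s * s = 1 by case: s1 => ->; rewrite ?mulrNN mulr1.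
have key u : A u -> s * psi1 u = phi u /\ s * psi2 u = phi u.
  apply: (phi_ext (fun u => s * psi1 u) (fun u => s * psi2 u) t) => //; [exact: sL|exact: sL|exact: sb|exact: sb|].
  move=> v Av; rewrite phiE// /convex_form (E1 (set_elt Av)) (E2 (set_elt Av)).
  have /(congr1 (fun F => F (set_elt Av))) := fg.
  by rewrite set_valE/= => ->; rewrite !fctE /GRing.scale/= mulrDr; ring.
split; apply/funext => u; have Au := set_valP u.
  have [h _] := key _ Au; rewrite -E1 set_valE -[LHS]mul1r -ss -mulrA h phiE//.
  by rewrite mulrA ss mul1r.
have [_ h] := key _ Au; rewrite -E2 set_valE -[LHS]mul1r -ss -mulrA h phiE//.
by rewrite mulrA ss mul1r.
Qed.

(** Compose [h] with a functional [e] norming [h x], giving [a] in [A]. An extreme form with value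
    [nrm a] at [a] is, up to sign, the evaluation at a point [z] of the boundary, whence [|h x|] is
    at most [nrm a], which is at most [|a z|] and so at most [|h z|]. *)
Lemma choquet_norming h x : H h -> h x != 0 ->
  exists2 z, choquet_boundary H z & `|h x| <= `|h z|.
Proof.
move=> Hh hx0; have [e [e1 ehx ce]] := norming_form (h x).
pose a : K -> R^o := e \o h.
have Aa : A a.
  apply: subset_closure; exists 1%N, (fun=> 1), (fun=> a); split.
    by move=> _; exists e => //; exists h.
  by rewrite big_ord1 scale1r.
have AA := canonical_subspace.
have sublin : sublinear_on A nrm.
  have [hD hZ] := @supnorm_sublinear R K R^o.
  by split=> [u v Au Av|b u b0 Au]; [apply: hD|apply: hZ] => //;
    exact: canonical_bounded.
have [phi [phiL phin phia phi_ext]] := extreme_form AA sublin Aa.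
have [Phi [PhiL Phin PhiE]] := extend_form AA bounded_funs_subspace
  canonical_bounded (@supnorm_sublinear R K R^o) phiL phin.
have ax : `|a x| = `|h x| by rewrite /a/= ehx normr_id.
have nrm_a : `|h x| <= nrm a.
  by rewrite -ax; apply: le_supnorm; exact: canonical_bounded.
have phi_neq0 : exists2 a, A a & phi a != 0.
  exists a => //; rewrite phia gt_eqF//; apply: lt_le_trans nrm_a.
  by rewrite normr_gt0.
have [z [s [s1 phiz]]] := extreme_form_evaluation K_compact canonical_subspace
  canonical_continuous canonical_bounded PhiL Phin PhiE phi_ext phi_neq0.
exists z; first exact: evaluation_choquet phi_ext phiz.
apply: le_trans nrm_a _; rewrite -phia phiz//.
apply: le_trans (ler_norm _) _; rewrite normrM.
have -> : `|s| = 1 by case: s1 => ->; rewrite ?normrN1 ?normr1.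
by rewrite mul1r; exact: e1.
Qed.

End Choquet.

(** * Spaces without a copy of c0 *)

Section Disjointification.
Context {R : realType}.

Definition offdiag_le (a : nat -> nat -> R) (M : R) :=
  forall n (r : seq nat), uniq r -> n \notin r -> \sum_(m <- r) a n m <= M.

(* Rosenthal's lemma: either one of infinitely many disjoint blocks is good, or
   a choice of one bad row in every block lowers the bound by [eps]. *)
Lemma rosenthal (eps : R) k (a : nat -> nat -> R) : 0 <= eps ->
  offdiag_le a (k%:R * eps) ->
  exists2 s : nat -> nat, injective s & offdiag_le (fun n m => a (s n) (s m)) eps.
Proof.
move=> eps0; elim: k a => [a aM|k IH a aM].
  exists id => // n r ur nr; apply: le_trans (aM n r ur nr) _.
  by rewrite mul0r.
(* [e p] enumerates the [p]-th of infinitely many disjoint blocks of indices. *)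
pose e (p m : nat) : nat := pickle (p, m).
have e_inj p q m l : e p m = e q l -> p = q /\ m = l.
  by move=> /(pcan_inj pickleK) [].
have [[p good]|bad] := pselect (exists p,
    offdiag_le (fun n m => a (e p n) (e p m)) eps).
  by exists (e p) => // m l /e_inj[].
have {}bad p : exists nr : nat * seq nat, [/\ uniq nr.2, nr.1 \notin nr.2 &
    eps < \sum_(m <- nr.2) a (e p nr.1) (e p m)].
  have /existsNP[n /existsNP[r]] :
    ~ offdiag_le (fun n m => a (e p n) (e p m)) eps by move=> h; apply: bad; exists p.
  by move=> /not_implyP[ur /not_implyP[nr /negP]]; rewrite -ltNge; exists (n, r).
have [f fP] := choice bad.
pose t p := e p (f p).1.
have t_inj : injective t by move=> p q /e_inj[].
have [|s s_inj sP] := IH (fun p q => a (t p) (t q)).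
  move=> p r ur pr; have [ufp nfp ltf] := fP p.
  (* The row [t p] has a sum above [eps] inside its own block, and the other [t q] lie in other
     blocks; so at most [k%:R * eps] is left for them. *)
  have := aM (t p) (map t r ++ map (e p) (f p).2).
  rewrite big_cat !big_map/= cat_uniq !map_inj_uniq// ?ur ?ufp ?andbT/=; last first.
    by move=> m l /e_inj[].
  rewrite mem_cat negb_or mem_map// pr/=.
  have -> : ~~ has (mem (map t r)) (map (e p) (f p).2).
    apply/hasPn => _ /mapP[m mf ->]; apply/negP => /mapP[q qr /e_inj[pq _]].
    by move: pr; rewrite pq qr.
  have -> : t p \notin map (e p) (f p).2.
    apply/negP => /mapP[m mf /e_inj[_ pm]].
    by move: nfp; rewrite pm mf.
  by move=> /(_ isT isT); rewrite -natr1 mulrDl mul1r; lra.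
by exists (t \o s) => //; exact: inj_comp.
Qed.

End Disjointification.

(** * Unconditionally bounded series and copies of c0 *)

Section CopyOfC0.
Context {R : realType} {E : completeNormedModType R}.

(** Equivalently, the series of the [z m] is weakly unconditionally Cauchy; [M] is an explicit
    bound. *)
Definition unconditionally_bounded (z : nat -> E) (M : R) :=
  forall (r : seq nat) (theta : nat -> R), uniq r -> (forall m, `|theta m| <= 1) ->
  `|\sum_(m <- r) theta m *: z m| <= M.

Section Sums.
Variables (z : nat -> E) (M : R).
Hypothesis zM : unconditionally_bounded z M.

Lemma unconditional_ge0 : 0 <= M.
Proof. by have := @zM [::] (fun=> 0) isT; rewrite big_nil !normr0; apply. Qed.

Lemma unconditional_sum_le (r : seq nat) (theta : nat -> R) C : uniq r -> 0 <= C ->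
  (forall m, m \in r -> `|theta m| <= C) ->
  `|\sum_(m <- r) theta m *: z m| <= C * M.
Proof.
move=> ur C0 thC; have [C_eq0|C_neq0] := eqVneq C 0.
  rewrite big_seq big1 ?normr0 ?C_eq0 ?mul0r// => m mr.
  have := thC m mr; rewrite C_eq0 normr_le0 => /eqP ->; exact: scale0r.
have Cp : 0 < C by rewrite lt_neqAle eq_sym C_neq0.
(* The coefficients are controlled on [r] only, so they are set to 0 elsewhere. *)
pose th m := if m \in r then C^-1 * theta m else 0.
have := @zM r th ur.
have -> : \sum_(m <- r) th m *: z m = C^-1 *: \sum_(m <- r) theta m *: z m.
  rewrite scaler_sumr big_seq [RHS]big_seq; apply: eq_bigr => m mr.
  by rewrite /th mr scalerA.
rewrite normrZ gtr0_norm ?invr_gt0// ler_pdivrMl//; apply => m.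
rewrite /th; case: ifP => [mr|]; last by rewrite normr0.
by rewrite normrM gtr0_norm ?invr_gt0// ler_pdivrMl// mulr1; exact: thC.
Qed.

Lemma unconditional_form (phi : {scalar E}) (r : seq nat) : uniq r ->
  (forall u, `|phi u| <= `|u|) -> \sum_(m <- r) `|phi (z m)| <= M.
Proof.
move=> ur phi1; apply: le_trans (@zM r (fun m => Num.sg (phi (z m))) ur _).
  apply: le_trans (phi1 _); apply: le_trans (ler_norm _).
  rewrite linear_sum/=; apply: ler_sum => m _.
  by rewrite linearZ/= normrEsg.
by move=> m; rewrite normr_sg; case: (_ != 0).
Qed.

Section Embedding.
Variable delta : R.
Variable phi : nat -> {scalar E}.
Hypotheses (delta_gt0 : 0 < delta) (z_delta : forall n, delta <= phi n (z n))
  (phi1 : forall n u, `|phi n u| <= `|u|)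
  (offdiag : offdiag_le (fun n m => `|phi n (z m)|) (delta / 2)).

Let part (u : nat -> R) n : E := \sum_(0 <= m < n) u m *: z m.

Let c0_bounded (u : nat -> R^o) : c0 u -> bounded_funs nat R^o u.
Proof.
move=> /cvgP/cvg_seq_bounded [N [_ uN]]; exists (N + 1) => n.
by apply: uN; rewrite ?ltrDl.
Qed.

Let part_cvg (u : nat -> R^o) : c0 u -> cvgn (part u).
Proof.
move=> cu; apply: cauchy_cvg; apply/cauchy_seriesP => e e0.
have M0 := unconditional_ge0.
have e1 : 0 < e / (M + 1) by rewrite divr_gt0// ltr_wpDl.
have /cvgrPdist_le/(_ _ e1) [N _ uN] := cu.
exists ([set n | (N <= n)%N], [set n | (N <= n)%N]); first by split; exists N.
move=> [n m] /= [Nn Nm].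
apply: le_lt_trans (@unconditional_sum_le (index_iota n m) u (e / (M + 1))
  (iota_uniq _ _) (ltW e1) _) _.
  move=> k; rewrite mem_index_iota => /andP[nk _].
  by have := uN k (leq_trans Nn nk); rewrite sub0r normrN.
by rewrite -mulrA -[ltRHS]mulr1 ltr_pM2l// mulrC ltr_pdivrMr ?mul1r ?ltrDl// ltr_wpDl.
Qed.

Let emb (u : @c0 R) : E := lim (part (val u) @ \oo).

Let emb_cvg (u : @c0 R) : part (val u) @ \oo --> emb u.
Proof. by apply: part_cvg; exact: set_valP. Qed.

(** The embedding sends [u] to the sum of the [u m *: z m]. Applying [phi n], the diagonal term is
    at least [delta * |u n|] and the others add up to at most half of [delta] times the norm of [u];
    taking the supremum over [n] gives the lower bound [delta / 2]. *)
Lemma contains_c0_unconditional : contains_c0 E.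
Proof.
have embL : linear_on emb.
  move=> a u v w wE; apply/cvg_lim => //.
  have -> : part (val w) = (fun n => a *: part (val u) n + part (val v) n).
    apply/funext => n; rewrite /part scaler_sumr -big_split; apply: eq_bigr => m _.
    by move: wE; rewrite set_valE => ->; rewrite !fctE scalerDl scalerA.
  by apply: cvgD; [apply: cvgZl_tmp|]; exact: emb_cvg.
exists emb => //; exists (delta / 2), (M + 1).
have M0 := unconditional_ge0.
split; [by rewrite divr_gt0|by rewrite ltr_wpDl|move=> u].
have bu := c0_bounded (set_valP u).
have nc : `|part (val u) n| @[n --> \oo] --> `|emb u| by apply: cvg_norm; exact: emb_cvg.
pose w : nat -> R := val u; pose sn : R := supnorm (val u : nat -> R^o).
have s0 : 0 <= sn by exact: supnorm_ge0.
have ws n : `|w n| <= sn by exact: (le_supnorm n bu).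
change (delta / 2 * sn <= `|emb u| /\ `|emb u| <= (M + 1) * sn); split.
  have key n : delta * `|w n| <= `|emb u| + delta / 2 * sn.
    rewrite -lerBlDr; apply: (cvgr_to_ge nc).
    exists n.+1 => // N /= nN.
    apply: le_trans (phi1 n _).
    have nr : n \in index_iota 0 N by rewrite mem_index_iota.
    rewrite /part (bigD1_seq n)//=; last exact: iota_uniq.
    rewrite linearD [phi n (_ *: _)]linearZ/= -/(w n).
    set s := \sum_(i <- _ | _) _.
    have h1 : `|phi n s| <= sn * (delta / 2).
      rewrite /s linear_sum/=; apply: le_trans (ler_norm_sum _ _ _) _.
      rewrite -big_filter.
      have := @offdiag n [seq i <- index_iota 0 N | i != n].
      rewrite filter_uniq ?iota_uniq// mem_filter eqxx/= => /(_ isT isT).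
      move=> /(ler_wpM2l s0); apply: le_trans; rewrite mulr_sumr; apply: ler_sum.
      by move=> i _; rewrite linearZ/= normrM ler_wpM2r//; exact: ws.
    have h2 : delta * `|w n| <= `|w n * phi n (z n)|.
      rewrite normrM mulrC ler_wpM2l//.
      exact: le_trans (z_delta n) (ler_norm _).
    by apply: le_trans (lerB_normD _ _); apply: lerB; rewrite // mulrC.
  have : sn <= (`|emb u| + delta / 2 * sn) / delta.
    apply: supnorm_le; first by have d0 := ltW delta_gt0; rewrite divr_ge0// addr_ge0// mulr_ge0// divr_ge0.
    by move=> n; rewrite ler_pdivlMr// mulrC; exact: key.
  by rewrite ler_pdivlMr//; lra.
apply: (cvgr_to_le nc); near=> N.
rewrite mulrC; apply: le_trans (@unconditional_sum_le (index_iota 0 N) w sn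
  (iota_uniq _ _) s0 _) _.
  by move=> m _; exact: ws.
by rewrite ler_wpM2l// lerDl.
Unshelve. all: by end_near. Qed.

End Embedding.
End Sums.

Lemma unconditional_subseq (z : nat -> E) M (t : nat -> nat) : injective t ->
  unconditionally_bounded z M -> unconditionally_bounded (z \o t) M.
Proof.
move=> t_inj zM r th ur th1.
have := zM (map t r) (fun k => th (nth 0 r (index k (map t r)))).
rewrite map_inj_uniq// big_map => /(_ ur (fun _ => th1 _)).
congr (`|_| <= M); rewrite big_seq [RHS]big_seq; apply: eq_bigr => m mr.
by rewrite index_map// nth_index.
Qed.

(* Bessaga and Pelczynski *)
Lemma unconditional_vanishing (z : nat -> E) (M delta : R) : ~ contains_c0 E ->
  unconditionally_bounded z M -> 0 < delta ->
  exists N, forall n, (N <= n)%N -> `|z n| < delta.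
Proof.
move=> nc0 zM delta0; apply: contrapT => noN; apply: nc0.
have far N : exists n, (N <= n)%N /\ delta <= `|z n|.
  apply: contrapT => h; apply: noN; exists N => n Nn.
  by rewrite ltNge; apply/negP => zn; apply: h; exists n.
have [f fP] := choice far.
(* [t] enumerates indices of terms of norm at least [delta], each search starting beyond the
   previous index. *)
pose t k := iter k (fun m => f m.+1) (f 0).
have t_incr k : (t k < t k.+1)%N by have [] := fP (t k).+1.
have t_inj : injective t.
  have t_lt : {homo t : i j / (i < j)%N} by apply: homo_ltn => //; exact: ltn_trans.
  by move=> i j tij; have [/t_lt|/t_lt|//] := ltngtP i j; rewrite tij ltnn.
have t_delta k : delta <= `|z (t k)| by case: k => [|k]; exact: (fP _).2.
have zM1 := unconditional_subseq t_inj zM.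
have [phi phiP] := choice (fun n => norming_form (z (t n))).
have M0 := unconditional_ge0 zM.
(* [unconditional_form] bounds every row by [M], and [M] is at most this multiple of [delta / 2],
   the form that [rosenthal] takes. *)
have off : offdiag_le (fun n m => `|phi n (z (t m))|)
    ((Num.truncn (M / (delta / 2))).+1%:R * (delta / 2)).
  move=> n r ur _; have [phi1 _ _] := phiP n.
  apply: le_trans (unconditional_form zM1 ur phi1) _.
  by rewrite -ler_pdivrMr ?divr_gt0//; apply/ltW/truncnS_gt.
have [|s s_inj sP] := rosenthal _ off; first by rewrite ltW ?divr_gt0.
apply: (@contains_c0_unconditional ((z \o t) \o s) M _ delta (phi \o s)) => //.
- exact: unconditional_subseq.
- by move=> n /=; have [_ -> _] := phiP (s n).
- by move=> n u /=; have [h _ _] := phiP (s n).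
Qed.

End CopyOfC0.

(** * Countable compact spaces *)

Section CountableCompact.
Context {T : topologicalType}.
Hypotheses (T_compact : compact [set: T]) (T_haus : hausdorff_space T).

Lemma clopenI (A B : set T) : clopen A -> clopen B -> clopen (A `&` B).
Proof. by move=> [oA cA] [oB cB]; split; [exact: openI|exact: closedI]. Qed.

Lemma clopenU (A B : set T) : clopen A -> clopen B -> clopen (A `|` B).
Proof. by move=> [oA cA] [oB cB]; split; [exact: openU|exact: closedU]. Qed.

Lemma clopenC (A : set T) : clopen A -> clopen (~` A).
Proof. by move=> [oA cA]; split; [exact: closed_openC|exact: open_closedC]. Qed.

Lemma clopenD (A B : set T) : clopen A -> clopen B -> clopen (A `\` B).
Proof. by move=> cA cB; rewrite setDE; apply: clopenI => //; exact: clopenC. Qed.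

Lemma clopen_set0 : clopen (set0 : set T).
Proof. by split; [exact: open0|exact: closed0]. Qed.

Lemma closed_point (x : T) : closed [set x].
Proof. by apply: accessible_closed_set1; exact: hausdorff_accessible. Qed.

(** For infinite [S], the sets containing all but finitely many points of [S] form a proper filter,
    and a cluster point of it in [L] is a limit point of [S]. *)
Lemma infinite_limit_point (L S : set T) : closed L -> S `<=` L ->
  L `&` limit_point S = set0 -> finite_set S.
Proof.
move=> cL SL LS0; apply: contrapT => infS.
pose F : set_system T := [set A | finite_set (S `\` A)].
have FF : ProperFilter F.
  split; first by rewrite /F/= setD0.
  split=> [|A B FA FB|A B AB].
  - by rewrite /F/= setDT; exact: finite_set0.
  - by rewrite /F/= setDIr finite_setU.
  - by apply: sub_finite_set => x [Sx nBx]; split=> // /AB.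
have FL : F L by rewrite /F/= (_ : S `\` L = set0)// setD_eq0.
have compL : compact L by apply: subclosed_compact T_compact _.
have [x [Lx clx]] := @compL F FF FL.
have : (L `&` limit_point S) x; last by rewrite LS0.
split=> // U xU; have [|y [[Sy yx] Uy]] := clx (S `\ x) U _ xU.
  apply: (@sub_finite_set _ _ [set x]); last exact: finite_set1.
  by move=> y [Sy nSy]; apply: contrapT => yx; apply: nSy.
by exists y; split=> //; apply/eqP.
Qed.

Lemma limit_point_openI (C D : set T) x : open C -> C x -> limit_point D x ->
  limit_point (C `&` D) x.
Proof.
move=> oC Cx Dx U xU; have [y [yx Dy [Uy Cy]]] := Dx (U `&` C)
  (filterI xU (open_nbhs_nbhs (conj oC Cx))).
by exists y; split.
Qed.

Lemma limit_pointS (C D : set T) : C `<=` D -> limit_point C `<=` limit_point D.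
Proof. by move=> CD x Cx U /Cx[y [yx /CD Dy Uy]]; exists y. Qed.

Lemma finite_no_limit_point (S : set T) x : finite_set S -> ~ limit_point S x.
Proof.
move=> finS Sx.
have cl : closed (S `\ x).
  apply: compact_closed => //; apply: finite_compact; exact: finite_setD.
have [|y [yx Sy []]] := Sx (~` (S `\ x)).
  by apply: open_nbhs_nbhs; split; [exact: closed_openC|move=> [_ /(_ erefl)]].
by split=> //; apply/eqP.
Qed.

Context {R : realType}.
Hypothesis T_countable : countable [set: T].

(** A Urysohn function takes only countably many values, so it omits some [r] in []0, 1[], and its
    sublevel set at [r] is clopen. *)
Lemma clopen_nbhs (x : T) (U : set T) : nbhs x U ->
  exists C, [/\ clopen C, C x & C `<=` U].
Proof.
rewrite nbhsE => -[V [oV Vx] VU].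
have sep : uniform_separator [set x] (~` V).
  apply: normal_uniform_separator; first exact: compact_normal.
  - exact: closed_point.
  - exact: open_closedC.
  - by apply/seteqP; split=> // y [-> nVx].
pose f : T -> R := Urysohn [set x] (~` V).
have fx : f x = 0.
  by apply: (Urysohn_sub0 sep); exists x.
have fV y : ~ V y -> f y = 1 by move=> nVy; apply: (Urysohn_sub1 sep); exists y.
have [r [r0 r1 fr]] : exists r, [/\ 0 < r, r < 1 & forall y, f y != r].
  apply: contrapT => nor.
  have sub : (`]0, 1[ : set R) `<=` range f.
    move=> r; rewrite /= in_itv/= => /andP[r0 r1]; apply: contrapT => fr.
    by apply: nor; exists r; split=> // y; apply/eqP => fy; apply: fr; exists y.
  have /countable_lebesgue_measure0 : countable (`]0, 1[ : set R).
    apply: sub_countable (subset_card_le sub) _.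
    by apply: sub_countable (card_image_le f _) _.
  by rewrite lebesgue_measure_itv/= lte_fin ltr01 oppr0 adde0 => /eqP; rewrite onee_eq0.
have cf : continuous f by exact: Urysohn_continuous.
exists (f @^-1` [set t | t < r]); split.
- split; first by apply: open_comp => // y _; exact: cf.
  rewrite (_ : f @^-1` _ = f @^-1` [set t | t <= r]).
    by apply: closed_comp => // y _; exact: cf.
  apply/seteqP; split=> y /=; first exact: ltW.
  by rewrite le_eqVlt (negPf (fr y)).
- by rewrite /= fx.
- move=> y /= fyr; apply: VU; apply: contrapT => /fV fy1.
  by move: fyr; rewrite fy1; move: r1; lra.
Qed.

Lemma clopen_filter_meet (C : nat -> set T) (P : set T) : closed P ->
  (forall n, closed (C n)) -> (forall n, C n.+1 `<=` C n) ->
  (forall n, (C n `&` P) !=set0) -> exists x, P x /\ forall n, C n x.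
Proof.
move=> cP cC dC ne.
have mono m n : (m <= n)%N -> C n `<=` C m.
  by move=> /subnK <-; elim: (n - m)%N => // k IH x /dC/IH.
pose F := filter_from [set: nat] (fun n => C n `&` P).
have FF : ProperFilter F.
  apply: filter_from_proper => [|n _]; last exact: ne.
  apply: filter_from_filter; first by exists 0%N.
  move=> m n _ _; exists (maxn m n) => // x [Cx Px]; split; split=> //.
    by apply: mono Cx; exact: leq_maxl.
  by apply: mono Cx; exact: leq_maxr.
have [x [_ clx]] := @T_compact F FF filterT.
have inC n : (C n `&` P) x.
  have : closed (C n `&` P) by exact: closedI.
  by apply; move=> U xU; apply: clx => //; exists n.
by exists x; split=> [|n]; [have [] := inC 0%N|have [] := inC n].
Qed.

(** A Baire argument: if every point of [P] were a limit point, there would be decreasing clopen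
    sets meeting [P], the one of index [n.+1] avoiding the point numbered [n]; by compactness they
    share a point, which has no number left. *)
Lemma closed_isolated (P : set T) : closed P -> P !=set0 ->
  exists2 x, P x & ~ limit_point P x.
Proof.
move=> cP [x0 Px0]; apply: contrapT => noiso.
have perf x : P x -> limit_point P x.
  by move=> Px; apply: contrapT => nPx; apply: noiso; exists x.
have [f /in2TT f_inj] := countable_injP _ T_countable.
pose T2 := {C : set T | clopen C /\ (C `&` P) !=set0}.
have step (C : T2) (n : nat) : exists C' : T2, sval C' `<=` sval C /\
    forall t, f t = n -> ~ sval C' t.
  case: C => C [cC [y [Cy Py]]]/=.
  have [z [Cz Pz zn]] : exists z, [/\ C z, P z & f z != n].
    have [fy|fy] := eqVneq (f y) n; last by exists y.
    have [z [zy Pz Cz]] := perf _ Py C (open_nbhs_nbhs (conj cC.1 Cy)).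
    by exists z; split=> //; apply: contraNneq zy => fz; apply/eqP/f_inj; rewrite fz.
  have onC : nbhs z (C `&` ~` [set t | f t = n]).
    apply: filterI; first by apply: open_nbhs_nbhs; split=> //; exact: cC.1.
    apply: open_nbhs_nbhs; split; last by move=> /= /eqP; rewrite (negPf zn).
    apply: closed_openC; apply: compact_closed => //; apply: finite_compact.
    have [[t ft]|nt] := pselect (exists t, f t = n).
      apply: (@sub_finite_set _ _ [set t]); last exact: finite_set1.
      by move=> u /= fu; apply: f_inj; rewrite fu.
    rewrite (_ : [set t | _] = set0); first exact: finite_set0.
    by apply/seteqP; split=> // t ft; apply: nt; exists t.
  have [C' [cC' C'z C'sub]] := clopen_nbhs onC.
  have C'P : (C' `&` P) !=set0 by exists z.
  exists (exist _ C' (conj cC' C'P)) => /=; split=> [t /C'sub[]//|t ft /C'sub[_ /=]].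
  by rewrite ft.
have start : T2.
  exists [set: T]; split; first by split; [exact: openT|exact: closedT].
  by exists x0.
have [g gP] := choice (fun Cn : T2 * nat => step Cn.1 Cn.2).
pose C := fix C n : T2 := if n is m.+1 then g (C m, m) else start.
have [||n|x [Px Cx]] := @clopen_filter_meet (fun n => sval (C n)) P cP.
- by move=> n; have [[]] := svalP (C n).
- by move=> n; have [] := gP (C n, n).
- by have [] := svalP (C n).
have [_ /(_ x erefl)] := gP (C (f x), f x).
by apply; exact: (Cx (f x).+1).
Qed.

End CountableCompact.

(** * Cantor-Bendixson derivatives along a well-order *)

Section WellOrder.
Variables (W : Type) (lt : W -> W -> Prop).

Definition strict_well_order :=
  [/\ forall i j k, lt i j -> lt j k -> lt i k,
      forall i j, i = j \/ lt i j \/ lt j i & well_founded lt].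

Variable T : topologicalType.

(* The Cantor-Bendixson derivatives, with an inductive predicate in place of a
   transfinite recursion. *)
Inductive derived : W -> set T :=
  derived_intro i x :
    (forall j, lt j i -> limit_point (derived j) x) -> derived i x.

End WellOrder.
Arguments derived {W} lt {T}.

Section Derived.
Context {W : Type} {lt : W -> W -> Prop} (lt_wo : strict_well_order lt).
Context {T : topologicalType}.
Hypotheses (T_compact : compact [set: T]) (T_haus : hausdorff_space T).
Local Notation D := (@derived W lt T).

Let ltT i j k : lt i j -> lt j k -> lt i k.
Proof. by have [h _ _] := lt_wo; exact: h. Qed.
Let lt_total i j : i = j \/ lt i j \/ lt j i.
Proof. by have [_ h _] := lt_wo; exact: h. Qed.
Let lt_wf : well_founded lt. Proof. by have [_ _ h] := lt_wo. Qed.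

Lemma derived_lim i j : lt j i -> D i `<=` limit_point (D j).
Proof. by move=> ji x Dx; case: Dx ji => i' y; apply. Qed.

Lemma derived_anti i j : lt j i -> D i `<=` D j.
Proof.
move=> ji x Dx; constructor => k kj; apply: derived_lim Dx; exact: ltT ji.
Qed.

Lemma limit_derived_anti i j : lt j i ->
  limit_point (D i) `<=` limit_point (D j).
Proof. by move=> /derived_anti; exact: limit_pointS. Qed.

Lemma closed_limit_point (S : set T) : closed (limit_point S).
Proof. by apply: limit_point_closed; exact: hausdorff_accessible. Qed.

Lemma derived_closed i : closed (D i).
Proof.
move=> x clx; constructor => j ji; apply: closed_limit_point.
by move=> U /clx [y [/(derived_lim ji) Dy Uy]]; exists y.
Qed.

Lemma limit_derived_sub i : limit_point (D i) `<=` D i.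
Proof. by move=> x Dx; apply: derived_closed; exact: subset_limit_point. Qed.

(** The traces on [L] of the sets [limit_point (D j)], for [j] below [i], are closed and decreasing.
    Were none of them empty, compactness would give a common point, which lies in [D i] by
    definition. *)
Lemma disjoint_derived (L : set T) i : closed L -> L !=set0 ->
  L `&` D i = set0 -> exists2 j, lt j i & L `&` limit_point (D j) = set0.
Proof.
move=> cL [x0 Lx0] LD0; apply: contrapT => noj.
have ne j : lt j i -> (L `&` limit_point (D j)) !=set0.
  by move=> ji; apply/set0P/eqP => LD; apply: noj; exists j.
(* At the least index the derivative is the whole space, which [L] meets. *)
have [j0 j0i] : exists j, lt j i.
  apply: contrapT => noj'.
  have : (L `&` D i) x0; last by rewrite LD0.
  by split=> //; constructor => j ji; exfalso; apply: noj'; exists j.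
pose F := filter_from [set j | lt j i] (fun j => L `&` limit_point (D j)).
have FF : ProperFilter F.
  apply: filter_from_proper => [|j ji]; last exact: ne.
  apply: filter_from_filter; first by exists j0.
  move=> j k ji ki; have [->|[jk|kj]] := lt_total j k.
  - by exists k => // x [].
  - exists k => // x [Lx Dx]; split; split=> //; exact: limit_derived_anti Dx.
  - exists j => // x [Lx Dx]; split; split=> //; exact: limit_derived_anti Dx.
have [x [_ clx]] := @T_compact F FF filterT.
have inF j : lt j i -> (L `&` limit_point (D j)) x.
  move=> ji; have cLj : closed (L `&` limit_point (D j)).
    by apply: closedI => //; exact: closed_limit_point.
  by apply: cLj => U xU; apply: clx => //; exists j.
have : (L `&` D i) x; last by rewrite LD0.
split; first by have [] := inF _ j0i.
by constructor => j ji; have [] := inF _ ji.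
Qed.

Lemma disjoint_derived_finite (L : set T) j : closed L ->
  L `&` limit_point (D j) = set0 -> finite_set (L `&` D j).
Proof.
move=> cL LD0; apply: (infinite_limit_point T_compact cL) => [x []//|].
apply/seteqP; split=> // x [Lx DLx].
have : (L `&` limit_point (D j)) x; last by rewrite LD0.
by split=> //; apply: limit_pointS DLx => y [].
Qed.

Lemma open_derived_infinite (A : set T) i j x : open A -> A x -> D i x ->
  lt j i -> ~ finite_set (A `&` D j).
Proof.
move=> oA Ax Dx ji finA.
have := @finite_no_limit_point _ T_haus _ x finA; apply.
by apply: limit_point_openI => //; exact: derived_lim Dx.
Qed.

Context {R : realType}.
Hypothesis T_countable : countable [set: T].

Let clopen_at := @clopen_nbhs T T_compact T_haus R T_countable.
Let isolated_in := @closed_isolated T T_compact T_haus R T_countable.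

Hypothesis W_large : forall f : W -> T, ~ injective f.

(** Otherwise an isolated point could be chosen in every derivative. It lies in no later derivative,
    so the choice would inject [W] into [T]. *)
Lemma derived_vanishes : exists i, D i = set0.
Proof.
apply: contrapT => noi.
have ne i : D i !=set0 by apply/set0P/eqP => Di; apply: noi; exists i.
have iso i : exists x, D i x /\ ~ limit_point (D i) x.
  by have [x Dx nDx] := isolated_in (derived_closed (i := i)) (ne i); exists x.
have [f fP] := choice iso; apply: (W_large (f := f)) => i j fij.
have [//|[ij|ji]] := lt_total i j.
- have [Dj _] := fP j; have [_ nD] := fP i; exfalso; apply: nD.
  by rewrite fij; exact: derived_lim Dj.
- have [Di _] := fP i; have [_ nD] := fP j; exfalso; apply: nD.
  by rewrite -fij; exact: derived_lim Di.
Qed.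

(** For open [A], [i] is the index of the last derivative that meets [A], since meeting a later one
    would make [A] contain infinitely many points of [D i]. *)
Definition cb_type (A : set T) i (s : seq T) :=
  [/\ (0 < size s)%N, uniq s & A `&` D i = [set` s]].

(** Descend from an index whose derivative misses [A]: below it there is one whose trace on [A] is
    finite. If that trace is empty, the descent goes on; it stops by well-foundedness. *)
Lemma cb_type_exists (A : set T) : clopen A -> A !=set0 ->
  exists i s, cb_type A i s.
Proof.
move=> [oA cA] A0.
have [i Di] := derived_vanishes.
have {Di} : A `&` D i = set0 by rewrite Di setI0.
elim: (lt_wf i) => {}i _ IH AD0.
have [j ji ADj] := disjoint_derived cA A0 AD0.
have [/IH|ADn] := eqVneq (A `&` D j) set0; first exact.
have /finite_seqP[s sE] := disjoint_derived_finite cA ADj.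
exists j, (undup s); split; last 2 first.
- exact: undup_uniq.
- by rewrite sE; apply/seteqP; split=> x /=; rewrite mem_undup.
- case: s sE => [sE|a s _].
    by move: ADn; rewrite sE; case/eqP; apply/seteqP; split.
  by have := mem_undup (a :: s) a; rewrite mem_head; case: (undup _).
Qed.

Lemma cb_type_finite (A : set T) i s : cb_type A i s -> finite_set (A `&` D i).
Proof. by move=> [_ _ ->]; exact: finite_seq. Qed.

Lemma cb_type_point (A : set T) i s : cb_type A i s -> exists x, A x /\ D i x.
Proof.
case: s => [[]//|x s [_ _ sE]]; exists x.
have : (A `&` D i) x by rewrite sE /= mem_head.
by case.
Qed.

Lemma cb_type_inj (A : set T) i j s t : open A ->
  cb_type A i s -> cb_type A j t -> i = j /\ size s = size t.
Proof.
have aux k l u v : open A -> cb_type A k u -> cb_type A l v -> ~ lt k l.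
  move=> oA /cb_type_finite finA /cb_type_point [x [Ax Dx]] kl.
  exact: open_derived_infinite oA Ax Dx kl finA.
move=> oA tA tA'; have ij : i = j.
  have [//|[ij|ji]] := lt_total i j; exfalso.
    exact: (aux _ _ _ _ oA tA tA' ij).
  exact: (aux _ _ _ _ oA tA' tA ji).
split=> //; move: tA tA'; rewrite ij => -[_ us sE] [_ ut tE].
apply/perm_size/uniq_perm => // x.
apply/idP/idP => h.
  by have : (A `&` D j) x; [rewrite sE|rewrite tE].
by have : (A `&` D j) x; [rewrite tE|rewrite sE].
Qed.

(** The points are taken one by one as isolated points of [D j] in a clopen neighbourhood of [x]
    that avoids the earlier ones; [x] itself is not among them, being a limit point. *)
Lemma isolated_many (B : set T) j x k : clopen B -> B x ->
  limit_point (D j) x -> exists u, [/\ uniq u, size u = k &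
    forall y, y \in u -> [/\ B y, D j y & ~ limit_point (D j) y]].
Proof.
move=> cB Bx Dx; elim: k => [|k [u [uu su uP]]]; first by exists [::].
have xU : nbhs x (B `&` ~` [set` u]).
  apply: open_nbhs_nbhs; split; last first.
    by split=> // /uP[_ _]; exact.
  apply: openI; first exact: cB.1.
  by apply: closed_openC; apply: compact_closed => //; exact/finite_compact/finite_seq.
have [C [cC Cx CB]] := clopen_at xU.
have [||y [Cy Dy] nDy] := isolated_in (P := C `&` D j).
- by apply: closedI; [exact: cC.2|exact: derived_closed].
- by exists x; split=> //; exact: limit_derived_sub.
have [By yu] := CB _ Cy.
exists (y :: u); split=> /=; [by rewrite uu andbT; exact/negP|by rewrite su|].
move=> z; rewrite inE => /predU1P[->|/uP//]; split=> // nD; apply: nDy.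
by apply: limit_point_openI => //; exact: cC.1.
Qed.

Lemma pick_clopen (B : set T) j (u : seq T) : clopen B ->
  (forall y, y \in u -> [/\ B y, D j y & ~ limit_point (D j) y]) ->
  exists C, [/\ clopen C, C `<=` B & C `&` D j = [set` u]].
Proof.
move=> cB; elim: u => [_|y u IH uP].
  exists set0; split; [exact: clopen_set0|by []|].
  by rewrite set0I; apply/seteqP; split.
have [|C [cC CB CD]] := IH; first by move=> z zu; apply: uP; rewrite inE zu orbT.
have [By Dy nDy] := uP y (mem_head _ _).
move: (nDy); rewrite not_limit_pointE => -[V yV DV].
have [C' [cC' C'y C'V]] := clopen_at (filterI yV (open_nbhs_nbhs (conj cB.1 By))).
exists (C `|` C'); split; first exact: clopenU.
  by move=> z [/CB//|/C'V[]].
rewrite setIUl CD; apply/seteqP; split=> z /=.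
  move=> [zu|[/C'V[Vz _] Dz]]; first by rewrite inE zu orbT.
  by rewrite inE (DV z (conj Dz Vz)) eqxx.
rewrite inE => /predU1P[->|zu]; last by left.
by right.
Qed.

Lemma split_type_eq (B : set T) i t n1 n2 : clopen B -> cb_type B i t ->
  (0 < n1)%N -> (0 < n2)%N -> size t = (n1 + n2)%N ->
  exists C t1 t2, [/\ clopen C, C `<=` B, cb_type (B `\` C) i t1,
    cb_type C i t2 & size t1 = n1 /\ size t2 = n2].
Proof.
move=> cB tB n1p n2p tn; have [_ ut tE] := tB.
have [|C [cC CB CE]] := @pick_clopen B i (take n2 t) cB.
  move=> y /mem_take yt.
  have [By Dy] : (B `&` D i) y by rewrite tE.
  (* The open set [B] contains only finitely many points of [D i], so none of them is a limit point
     of [D i]. *)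
  split=> // Dly.
  have := @finite_no_limit_point _ T_haus _ y (cb_type_finite tB); apply.
  by apply: limit_point_openI => //; exact: cB.1.
have sz1 : size (drop n2 t) = n1 by rewrite size_drop tn addnK.
have sz2 : size (take n2 t) = n2 by rewrite size_take_min tn; apply/minn_idPl; exact: leq_addl.
exists C, (drop n2 t), (take n2 t); split=> //.
- split; rewrite ?sz1 ?drop_uniq//.
  apply/seteqP; split=> x /=.
    move=> [[Bx nCx] Dx]; have : (B `&` D i) x by [].
    rewrite tE /= -{1}(cat_take_drop n2 t) mem_cat => /orP[xt|//].
    have : (C `&` D i) x by rewrite CE.
    by case.
  move=> xt; have [Bx Dx] : (B `&` D i) x by rewrite tE /= (mem_drop xt).
  split=> //; split=> // Cx; have : (C `&` D i) x by [].
  rewrite CE /= => xt'; move: ut; rewrite -(cat_take_drop n2 t) cat_uniq.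
  by move=> /and3P[_ /hasPn/(_ _ xt)]; rewrite /= xt'.
- by split; rewrite ?sz2 ?take_uniq.
Qed.

(** [C] is built around [n] isolated points of [D j]. It misses [D i], all of whose points are limit
    points of [D j], so the type of the rest is unchanged. *)
Lemma split_type_lt (B : set T) i j t n : clopen B -> cb_type B i t ->
  (0 < n)%N -> lt j i ->
  exists C t2, [/\ clopen C, C `<=` B, cb_type (B `\` C) i t,
    cb_type C j t2 & size t2 = n].
Proof.
move=> cB tB n0 ji; have [x [Bx Dx]] := cb_type_point tB.
have [u [uu su uP]] := isolated_many n cB Bx (derived_lim ji Dx).
have [C [cC CB CE]] := pick_clopen cB uP.
exists C, u; split=> //; last by split; rewrite ?su.
have [t0 ut tE] := tB; split=> //; rewrite -tE; apply/seteqP; split=> y.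
  by move=> [[By _] Dy].
move=> [By Dy]; split=> //; split=> // Cy.
have : (C `&` D j) y by split=> //; exact: derived_anti Dy.
rewrite CE /= => /uP[_ _]; apply; exact: derived_lim Dy.
Qed.

Lemma cb_type_union_eq (A1 A2 : set T) i s1 s2 : A1 `&` A2 = set0 ->
  cb_type A1 i s1 -> cb_type A2 i s2 -> cb_type (A1 `|` A2) i (s1 ++ s2).
Proof.
move=> A12 [s10 us1 s1E] [s20 us2 s2E]; split.
- by rewrite size_cat addn_gt0 s10.
- rewrite cat_uniq us1 us2 andbT; apply/hasPn => x xs2; apply/negP => xs1.
  have [A1x _] : (A1 `&` D i) x by rewrite s1E.
  have [A2x _] : (A2 `&` D i) x by rewrite s2E.
  by have : (A1 `&` A2) x by []; rewrite A12.
- rewrite setIUl s1E s2E; apply/seteqP; split=> x /=; rewrite mem_cat.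
    by case=> ->; rewrite ?orbT.
  by move/orP.
Qed.

Lemma cb_type_union_lt (A1 A2 : set T) i j s1 s2 : open A2 -> lt j i ->
  cb_type A1 i s1 -> cb_type A2 j s2 -> cb_type (A1 `|` A2) i s1.
Proof.
move=> oA2 ji [s10 us1 s1E] tA2; split=> //.
rewrite setIUl s1E [A2 `&` _](_ : _ = set0) ?setU0//.
apply/seteqP; split=> // x [A2x Dx].
exact: open_derived_infinite oA2 A2x Dx ji (cb_type_finite tA2).
Qed.

End Derived.

(** * Clopen sets with the same Cantor-Bendixson invariants *)

Section CbEquiv.
Context {W : Type} {lt : W -> W -> Prop} (lt_wo : strict_well_order lt).
Context {R : realType} {X Y : topologicalType}.
Hypotheses (X_compact : compact [set: X]) (X_haus : hausdorff_space X)
  (X_countable : countable [set: X])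
  (X_small : forall f : W -> X, ~ injective f).
Hypotheses (Y_compact : compact [set: Y]) (Y_haus : hausdorff_space Y)
  (Y_countable : countable [set: Y]).

Definition cb_equiv (A : set X) (B : set Y) :=
  (A = set0 /\ B = set0) \/
  exists i s t, [/\ size s = size t, cb_type (lt := lt) A i s & cb_type (lt := lt) B i t].

(** The extension step of the back-and-forth. If the two pieces of [A] have the same index, their
    numbers of points add up to that of [A]; otherwise the piece of larger index keeps the type of
    [A], and a set of the smaller type is cut out of [B]. *)
Lemma cb_equiv_split (A C : set X) (B : set Y) : clopen A -> clopen C ->
  clopen B -> cb_equiv A B ->
  exists C', [/\ clopen C', cb_equiv (A `&` C) (B `&` C') &
    cb_equiv (A `\` C) (B `\` C')].
Proof.
move=> cA cC cB AB.
have cAC := clopenI cA cC; have cADC := clopenD cA cC.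
have cT : clopen [set: Y] by split; [exact: openT|exact: closedT].
have [AC0|/set0P AC0] := eqVneq (A `&` C) set0.
  exists set0; split; first exact: clopen_set0.
    by left; rewrite setI0.
  rewrite setD0 (_ : A `\` C = A)//; apply/seteqP; split=> [x []//|x Ax].
  by split=> // Cx; have : (A `&` C) x by []; rewrite AC0.
have [ADC0|/set0P ADC0] := eqVneq (A `\` C) set0.
  exists setT; split=> //; last by left; rewrite setDT.
  rewrite setIT (_ : A `&` C = A)//; apply/seteqP; split=> [x []//|x Ax].
  split=> //; apply: contrapT => nCx; have : (A `\` C) x by [].
  by rewrite ADC0.
have [[A0 _]|[i [s [t [st tA tB]]]]] := AB.
  by move: AC0 => [x]; rewrite A0 set0I.
have type_exists := cb_type_exists lt_wo X_compact X_haus (R := R) X_countable X_small.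
have [i1 [s1 tA1]] := type_exists _ cAC AC0.
have [i2 [s2 tA2]] := type_exists _ cADC ADC0.
have AE : A = (A `&` C) `|` (A `\` C).
  by rewrite setDE -setIUr setUv setIT.
have disj : (A `&` C) `&` (A `\` C) = set0.
  by apply/seteqP; split=> // x [[_ Cx] [_ /(_ Cx)]].
have type_inj := fun j u => cb_type_inj (j := j) (t := u) lt_wo X_haus cA.1 tA.
have [s10 _ _] := tA1; have [s20 _ _] := tA2.
have [_ h _] := lt_wo; have [i12|[i12|i21]] := h i1 i2.
- subst i2.
  have := cb_type_union_eq disj tA1 tA2; rewrite -AE => /type_inj[ii1 ss].
  have [|C' [t1 [t2 [cC' C'B tB1 tB2 [st1 st2]]]]] := split_type_eq (R := R)
    Y_compact Y_haus Y_countable cB tB s20 s10.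
    by rewrite -st ss size_cat addnC.
  exists C'; split=> //; right; exists i1.
    by exists s1, t2; rewrite (setIidr C'B) -ii1 st2; split=> //; rewrite ii1.
  by exists s2, t1; rewrite -ii1 st1; split=> //; rewrite ii1.
- have := cb_type_union_lt X_haus cAC.1 i12 tA2 tA1.
  rewrite setUC -AE => /type_inj[ii2 ss].
  have [|C' [t2 [cC' C'B tB1 tB2 st2]]] := split_type_lt lt_wo (R := R)
    Y_compact Y_haus Y_countable cB tB s10 (j := i1); first by rewrite ii2.
  exists C'; split=> //; right.
    by exists i1, s1, t2; rewrite (setIidr C'B) st2.
  by exists i2, s2, t; rewrite -ii2 -st ss; split=> //; rewrite ii2.
- have := cb_type_union_lt X_haus cADC.1 i21 tA1 tA2.
  rewrite -AE => /type_inj[ii1 ss].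
  have [|C' [t2 [cC' C'B tB1 tB2 st2]]] := split_type_lt lt_wo (R := R)
    Y_compact Y_haus Y_countable cB tB s20 (j := i2); first by rewrite ii1.
  (* The set cut out of [B] matches the piece off [C] here, so the counterpart of [C] is its
     complement. *)
  exists (B `\` C'); split; first exact: clopenD.
    have -> : B `&` (B `\` C') = B `\` C' by apply: setIidr => x [].
    right; exists i1, s1, t.
    by rewrite -ii1 -st ss; split=> //; rewrite ii1.
  right; exists i2, s2, t2.
  by rewrite setDD (setIidr C'B) st2.
Qed.

Lemma cb_equiv_empty (A : set X) (B : set Y) : cb_equiv A B ->
  A = set0 <-> B = set0.
Proof.
move=> [[-> ->]//|[i [s [t [_ tA tB]]]]].
have [x [Ax _]] := cb_type_point tA; have [y [By _]] := cb_type_point tB.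
by split=> h; [move: Ax|move: By]; rewrite h.
Qed.

End CbEquiv.

(** * Homeomorphisms from matching trees of clopen sets *)

Section Tree.
Context {T : topologicalType}.

(* A binary tree of clopen sets; a node is the sequence of choices leading to
   it, most recent first. *)
Record clopen_tree (N : seq bool -> set T) := ClopenTree {
  tree_root : N [::] = setT;
  tree_step : forall s, exists2 c, clopen c &
    N (true :: s) = N s `&` c /\ N (false :: s) = N s `\` c }.

Definition separating (N : seq bool -> set T) :=
  forall x y, (forall s, N s x -> N s y) -> x = y.

Variable N : seq bool -> set T.
Hypothesis treeN : clopen_tree N.

Lemma tree_clopen s : clopen (N s).
Proof.
elim: s => [|b s IH].
  by rewrite (tree_root treeN); split; [exact: openT|exact: closedT].
have [c cc [Nt Nf]] := tree_step treeN s.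
by case: b; rewrite ?Nt ?Nf; [exact: clopenI|exact: clopenD].
Qed.

Lemma tree_sub b s : N (b :: s) `<=` N s.
Proof.
by have [c _ [Nt Nf]] := tree_step treeN s; case: b; rewrite ?Nt ?Nf => x [].
Qed.

(** Each level of the tree partitions the space, so the nodes containing [x] form a single branch,
    followed by testing membership in the [true] child. *)
Lemma tree_branch x : exists br : nat -> seq bool,
  [/\ forall n, size (br n) = n, forall n, N (br n) x,
      forall n, exists b, br n.+1 = b :: br n & forall s, N s x -> s = br (size s)].
Proof.
pose br := fix br n : seq bool :=
  if n is m.+1 then `[< N (true :: br m) x >] :: br m else [::].
have brN n : N (br n) x.
  elim: n => [|n IH] /=; first by rewrite (tree_root treeN).
  case: asboolP => // nN.
  have [c cc [Nt Nf]] := tree_step treeN (br n).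
  by rewrite Nf; split=> // cx; apply: nN; rewrite Nt.
exists br; split=> //.
- by elim=> //= n ->.
- by move=> n; eexists.
- elim=> // b s IH Nbs; have Ns := tree_sub Nbs.
  rewrite /= {1}(IH Ns) -(IH Ns); congr (_ :: _).
  have [c cc [Nt Nf]] := tree_step treeN s.
  case: b Nbs => Nbs; first by apply/esym/asboolP.
  apply/esym/asboolP => Ntx; move: Nbs Ntx; rewrite Nt Nf => -[_ ncx] [_ cx].
  exact: ncx.
Qed.

End Tree.

Section TreeMap.
Context {X Y : topologicalType} (NX : seq bool -> set X) (NY : seq bool -> set Y).
Hypotheses (Y_compact : compact [set: Y]) (treeX : clopen_tree NX)
  (treeY : clopen_tree NY) (sepY : separating NY).
Hypothesis NXY : forall s, NX s !=set0 -> NY s !=set0.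

(** [f x] is a common point of the nodes of [NY] along the branch of [x]. If none of these nodes
    were inside an open set [G] around [f x], compactness would give a common point outside [G],
    which [sepY] identifies with [f x]. *)
Lemma tree_map : exists2 f : X -> Y, continuous f &
  forall s x, NX s x -> NY s (f x).
Proof.
have key x : exists y, forall s, NX s x -> NY s y.
  have [br [_ brX brS brE]] := tree_branch treeX x.
  have [||n|y [_ yP]] := @clopen_filter_meet _ Y_compact (fun n => NY (br n)) setT closedT.
  - by move=> n; have [] := tree_clopen treeY (br n).
  - by move=> n; have [b ->] := brS n; exact: tree_sub.
  - by rewrite setIT; apply: NXY; exists x.
  - by exists y => s /brE ->.
have [f fP] := choice key; exists f => [x V|s x]; last exact: fP.
rewrite nbhsE => -[G [oG Gfx] GV].
have [br [_ brX brS brE]] := tree_branch treeX x.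
have [brY [brYsize brYY _ brYE]] := tree_branch treeY (f x).
have brYbr n : brY n = br n.
  have [br' [br'size br'X _ _]] := tree_branch treeX x.
  have E : br' n = br n by rewrite (brE _ (br'X n)) br'size.
  by rewrite -E (brYE _ (fP _ _ (br'X n))) br'size.
have [n nG] : exists n, NY (br n) `<=` G.
  apply: contrapT => noG.
  have [||n|n|y [nGy yP]] := @clopen_filter_meet _ Y_compact (fun n => NY (br n)) (~` G).
  - exact: open_closedC.
  - by move=> n; have [] := tree_clopen treeY (br n).
  - by have [b ->] := brS n; exact: tree_sub.
  - apply: contrapT => h; apply: noG; exists n => y Ny; apply: contrapT => nGy.
    by apply: h; exists y.
  - apply: nGy; suff <- : f x = y by [].
    by apply: sepY => s /brYE ->; rewrite brYbr; exact: yP.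
have : nbhs x (NX (br n)).
  by apply: open_nbhs_nbhs; split; [have [] := tree_clopen treeX (br n)|exact: brX].
by apply: filterS => x' /fP/nG/GV.
Qed.

End TreeMap.

Lemma tree_homeomorphic (X Y : topologicalType) (NX : seq bool -> set X)
    (NY : seq bool -> set Y) : compact [set: X] -> compact [set: Y] ->
  clopen_tree NX -> clopen_tree NY -> separating NX -> separating NY ->
  (forall s, NX s = set0 <-> NY s = set0) -> homeomorphic X Y.
Proof.
move=> cX cY tX tY sX sY NXY.
have [|f cf fP] := tree_map cY tX tY sY.
  by move=> s /set0P/eqP h; apply/set0P/eqP => /NXY.
have [|g cg gP] := tree_map cX tY tX sX.
  by move=> s /set0P/eqP h; apply/set0P/eqP => /NXY.
exists f, g; split=> // [x|y]; apply/esym.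
  by apply: sX => s /fP/gP.
by apply: sY => s /gP/fP.
Qed.

Section Vaught.
Context {X Y : topologicalType}.
Hypotheses (X_compact : compact [set: X]) (Y_compact : compact [set: Y]).
Variables (C : nat -> set X) (D : nat -> set Y).
Hypotheses (C_clopen : forall n, clopen (C n)) (D_clopen : forall n, clopen (D n)).
Hypotheses (C_sep : forall x x', x <> x' -> exists2 n, C n x & ~ C n x')
  (D_sep : forall y y', y <> y' -> exists2 n, D n y & ~ D n y').
Variable rel : set X -> set Y -> Prop.
Hypotheses (rel_empty : forall A B, rel A B -> A = set0 <-> B = set0)
  (rel_split : forall A B E, clopen A -> clopen B -> clopen E -> rel A B ->
     exists F, [/\ clopen F, rel (A `&` E) (B `&` F) & rel (A `\` E) (B `\` F)])
  (rel_split' : forall A B F, clopen A -> clopen B -> clopen F -> rel A B ->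
     exists E, [/\ clopen E, rel (A `&` E) (B `&` F) & rel (A `\` E) (B `\` F)])
  (rel_top : rel setT setT).

(** Two matching trees are built together, splitting alternately by a prescribed [D n] in [Y] and a
    prescribed [C n] in [X]. Every separating set gets used on every branch, so both trees separate
    points. *)
Lemma vaught_homeomorphic : homeomorphic X Y.
Proof.
pose good (AB : set X * set Y) := [/\ clopen AB.1, clopen AB.2 & rel AB.1 AB.2].
have step (p : (set X * set Y) * nat) : exists EF : set X * set Y,
    good p.1 -> [/\ clopen EF.1, clopen EF.2,
      good (p.1.1 `&` EF.1, p.1.2 `&` EF.2), good (p.1.1 `\` EF.1, p.1.2 `\` EF.2) &
      if odd p.2 then EF.1 = C p.2./2 else EF.2 = D p.2./2].
  case: p => -[A B] n /=; have [[cA cB AB]|ng] := pselect (good (A, B)); last first.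
    by exists (setT, setT) => /ng.
  case: (odd n).
    have [F [cF r1 r2]] := rel_split cA cB (C_clopen n./2) AB.
    exists (C n./2, F) => _; have cC := C_clopen n./2; split=> //; split=> //=.
    - exact: clopenI.
    - exact: clopenI.
    - exact: clopenD.
    - exact: clopenD.
  have [E [cE r1 r2]] := rel_split' cA cB (D_clopen n./2) AB.
  exists (E, D n./2) => _; have cD := D_clopen n./2; split=> //; split=> //=.
  - exact: clopenI.
  - exact: clopenI.
  - exact: clopenD.
  - exact: clopenD.
have [g gP] := choice step.
pose fix N (s : seq bool) : set X * set Y :=
  if s is b :: t then
    let AB := N t in let EF := g (AB, size t) in
    if b then (AB.1 `&` EF.1, AB.2 `&` EF.2) else (AB.1 `\` EF.1, AB.2 `\` EF.2)
  else (setT, setT).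
have N_good s : good (N s).
  elim: s => [|b s IH] /=.
    by split=> //=; split; do ?[exact: openT|exact: closedT].
  by have [_ _ h1 h2 _] := gP (N s, size s) IH; case: b.
have tX : clopen_tree (fst \o N).
  split=> // s; exists (g (N s, size s)).1; last by split.
  by have [] := gP (N s, size s) (N_good s).
have tY : clopen_tree (snd \o N).
  split=> // s; exists (g (N s, size s)).2; last by split.
  by have [] := gP (N s, size s) (N_good s).
apply: (tree_homeomorphic X_compact Y_compact tX tY).
- move=> x x' xx'; apply: contrapT => /C_sep[n Cx nCx'].
  have [br [brsize brX brS _]] := tree_branch tX x.
  (* [C n] splits the nodes of length [n.*2.+1], so its effect is visible one level further. *)
  have := xx' _ (brX n.*2.+2); have := brX n.*2.+2.
  have [b ->] := brS n.*2.+1 => /=.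
  have [_ _ _ _] := gP (N (br n.*2.+1), size (br n.*2.+1)) (N_good _).
  rewrite brsize /= odd_double /= uphalf_double => ->.
  by case: b => /= -[_ h1] [_ h2]; [exact: nCx'|exact: h1].
- move=> y y' yy'; apply: contrapT => /D_sep[n Dy nDy'].
  have [br [brsize brY brS _]] := tree_branch tY y.
  (* [D n] splits the nodes of length [n.*2]. *)
  have := yy' _ (brY n.*2.+1); have := brY n.*2.+1.
  have [b ->] := brS n.*2 => /=.
  have [_ _ _ _] := gP (N (br n.*2), size (br n.*2)) (N_good _).
  rewrite brsize /= odd_double /= doubleK => ->.
  by case: b => /= -[_ h1] [_ h2]; [exact: nDy'|exact: h1].
- by move=> s; have [_ _ /rel_empty] := N_good s.
Qed.

End Vaught.

(** The set numbered by the code of a pair of points separates that pair; numbers that code no such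
    pair get the whole space. *)
Lemma clopen_separating_sequence (R : realType) (T : topologicalType) :
  compact [set: T] -> hausdorff_space T -> countable [set: T] ->
  exists C : nat -> set T, (forall n, clopen (C n)) /\
    forall x y, x <> y -> exists2 n, C n x & ~ C n y.
Proof.
move=> cT hT ctT; have [f /in2TT f_inj] := countable_injP _ ctT.
have key (n : nat) : exists C : set T, clopen C /\
    forall x y, x <> y -> n = pickle (f x, f y) -> C x /\ ~ C y.
  have [[[x y] [xy nE]]|no] := pselect (exists xy : T * T,
      xy.1 <> xy.2 /\ n = pickle (f xy.1, f xy.2)); last first.
    exists setT; split; first by split; [exact: openT|exact: closedT].
    by move=> x y xy nE; exfalso; apply: no; exists (x, y).
  have [|C [cC Cx Cy]] := @clopen_nbhs _ cT hT R ctT x (~` [set y]).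
    apply: open_nbhs_nbhs; split=> //; apply: closed_openC; exact: closed_point.
  exists C; split=> // x' y' _; rewrite nE => /(pcan_inj pickleK)[/f_inj <- /f_inj <-].
  by split=> // /Cy; exact.
have [C CP] := choice key; exists C; split; first by move=> n; have [] := CP n.
move=> x y xy; have [_ h] := CP (pickle (f x, f y)).
by have [] := h x y xy erefl; exists (pickle (f x, f y)).
Qed.

Lemma cb_equiv_sym (W : Type) (lt : W -> W -> Prop) (X Y : topologicalType)
  (A : set X) (B : set Y) : cb_equiv (lt := lt) A B -> cb_equiv (lt := lt) B A.
Proof.
by case=> [[-> ->]|[i [s [t [st tA tB]]]]]; [left|right; exists i, t, s].
Qed.

(* Mazurkiewicz and Sierpinski *)
Lemma cb_equiv_homeomorphic (R : realType) (W : Type) (lt : W -> W -> Prop)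
    (X Y : topologicalType) : strict_well_order lt ->
  compact [set: X] -> hausdorff_space X -> countable [set: X] ->
  (forall f : W -> X, ~ injective f) ->
  compact [set: Y] -> hausdorff_space Y -> countable [set: Y] ->
  (forall f : W -> Y, ~ injective f) ->
  cb_equiv (lt := lt) [set: X] [set: Y] -> homeomorphic X Y.
Proof.
move=> wo cX hX ctX sX cY hY ctY sY XY.
have [C [cC C_sep]] := clopen_separating_sequence R cX hX ctX.
have [D [cD D_sep]] := clopen_separating_sequence R cY hY ctY.
apply: (vaught_homeomorphic cX cY cC cD C_sep D_sep) XY.
- exact: cb_equiv_empty.
- move=> A B E cA cB cE AB.
  exact: (cb_equiv_split wo (R := R) cX hX ctX sX cY hY ctY).
- move=> A B F cA cB cF /cb_equiv_sym AB.
  have [E [cE r1 r2]] := cb_equiv_split wo (R := R) cY hY ctY sY cX hX ctX cB cF cA AB.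
  by exists E; split=> //; exact: cb_equiv_sym.
Qed.

(** A well-ordering of the reals supplies more indices than a countable space has points, enough for
    the derivatives to vanish. *)
Lemma exists_large_well_order (R : realType) :
  exists (W : Type) (lt : W -> W -> Prop), strict_well_order lt /\
    forall T : Type, countable [set: T] -> forall f : W -> T, ~ injective f.
Proof.
have [r r_wo] := wochoice.well_ordering_principle R.
have min_ex (A : {pred R}) : (exists x, x \in A) ->
    exists z, z \in A /\ forall x, x \in A -> r z x.
  by move=> /r_wo [z [[zA zmin] _]]; exists z.
have r_anti x y : r x y -> r y x -> x = y.
  (* Both [x] and [y] are least in the pair, and the least element is unique. *)
  move=> xy yx; have [|z [_ zuniq]] := r_wo (mem [:: x; y]).
    by exists x; rewrite inE eqxx.
  have rr u : r u u.
    by have [|v []] := min_ex (pred1 u); [exists u; rewrite inE|rewrite inE => /eqP -> h; apply: h; rewrite inE].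
  have <- : z = x.
    apply: zuniq; split; first by rewrite !inE eqxx.
    by move=> u; rewrite !inE => /orP[/eqP ->|/eqP ->].
  apply: zuniq; split; first by rewrite !inE eqxx orbT.
  by move=> u; rewrite !inE => /orP[/eqP ->|/eqP ->].
have r_total x y : r x y \/ r y x.
  have [|z [zA zmin]] := min_ex (mem [:: x; y]); first by exists x; rewrite inE eqxx.
  move: zA; rewrite !inE => /orP[/eqP zE|/eqP zE]; [left|right]; rewrite -zE; apply: zmin.
    by rewrite !inE eqxx orbT.
  by rewrite !inE eqxx.
have r_trans x y z : r x y -> r y z -> r x z.
  move=> xy yz; have [|u [uA umin]] := min_ex (mem [:: x; y; z]).
    by exists x; rewrite inE eqxx.
  have := umin z; have := umin y; have := umin x; rewrite !inE !eqxx !orbT.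
  move=> /(_ isT) ux /(_ isT) uy /(_ isT) uz.
  move: uA; rewrite !inE => /or3P[/eqP uE|/eqP uE|/eqP uE]; rewrite uE in ux uy uz.
  - exact: uz.
  - by rewrite (r_anti x y xy ux).
  - by rewrite (r_anti z y uy yz).
exists R, (fun x y => r x y /\ x <> y); split.
  split.
  - move=> i j k [ij nij] [jk njk]; split; first exact: r_trans jk.
    by move=> ik; apply: njk; apply: r_anti => //; rewrite -ik.
  - move=> i j; have [->|ij] := pselect (i = j); first by left.
    right; have [h|h] := r_total i j; [by left|right; split=> // ji].
    by apply: ij.
  - move=> i; apply: contrapT => nacc.
    pose A : {pred R} := fun x => `[< ~ Acc (fun x y => r x y /\ x <> y) x >].
    have [|z [/asboolP nz zmin]] := min_ex A; first by exists i; apply/asboolP.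
    apply: nz; constructor => y [yz ynz]; apply: contrapT => ny.
    by apply: ynz; apply: r_anti => //; apply: zmin; apply/asboolP.
move=> T ctT f f_inj.
have /countable_lebesgue_measure0 : countable (`]0, 1[ : set R).
  have f_inj' : {in (`]0, 1[%classic : set R) &, injective f}.
    by move=> x y _ _; exact: f_inj.
  rewrite -(eq_countable (inj_card_eq f_inj')).
  exact: sub_countable (card_leT _) ctT.
by rewrite lebesgue_measure_itv/= lte_fin ltr01 oppr0 adde0 => /eqP; rewrite onee_eq0.
Qed.

(** * Separation of finitely many points *)

Lemma nbhs_all_seq (T : topologicalType) (I : eqType) (x : T) (s : seq I) (P : I -> set T) :
  (forall y, y \in s -> nbhs x (P y)) -> nbhs x [set z | forall y, y \in s -> P y z].
Proof.
elim: s => [_|y s IH sP]; first by apply: filterS filterT => z _ y.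
have h1 : nbhs x (P y) by apply: sP; exact: mem_head.
have h2 : nbhs x [set z | forall y, y \in s -> P y z].
  by apply: IH => z zs; apply: sP; rewrite inE zs orbT.
by apply: filterS2 h1 h2 => z Pz sz y'; rewrite inE => /predU1P[->|/sz].
Qed.

Lemma hausdorff_disjoint_nbhs (T : topologicalType) (x y : T) : hausdorff_space T ->
  x <> y -> exists U V, [/\ open U, open V, U x, V y & U `&` V = set0].
Proof.
rewrite open_hausdorff => hT /eqP xy; have [[U V]] := hT _ _ xy.
by move=> /= [/set_mem Ux /set_mem Vy] [oU oV /eqP UV]; exists U, V.
Qed.

Lemma hausdorff_separate_seq (T : topologicalType) (s : seq T) :
  hausdorff_space T -> exists U : T -> set T, (forall x, nbhs x (U x)) /\
    forall x y z, x \in s -> y \in s -> U x z -> U y z -> x = y.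
Proof.
move=> hT.
have sep (p : T * T) : exists UV : set T * set T, p.1 <> p.2 ->
    [/\ nbhs p.1 UV.1, nbhs p.2 UV.2 & UV.1 `&` UV.2 = set0].
  have [pp|pp] := pselect (p.1 = p.2); first by exists (setT, setT) => /(_ pp).
  have [U [V [oU oV Ux Vy UV]]] := hausdorff_disjoint_nbhs hT pp.
  by exists (U, V) => _; split=> //; exact: open_nbhs_nbhs.
have [f fP] := choice sep.
(* The pairs [(x, y)] and [(y, x)] are separated by independent choices, so both are intersected. *)
pose U x := [set z | forall y, y \in s -> x <> y -> (f (x, y)).1 z /\ (f (y, x)).2 z].
exists U; split.
  move=> x; apply: nbhs_all_seq => y ys.
  have [xy|xy] := pselect (x = y); first by apply: filterS filterT => z _ /(_ xy).
  have [h1 _ _] := fP (x, y) xy.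
  have [_ h2 _] := fP (y, x) (nesym xy).
  by apply: filterS2 h1 h2.
move=> x y z xs ys Ux Uy; apply: contrapT => xy.
have [h1 _] := Ux y ys xy; have [_ h2] := Uy x xs (nesym xy).
by have [_ _ h3] := fP (x, y) xy; have : set0 z by rewrite -h3.
Qed.

(** * Isomorphisms and Cantor-Bendixson derivatives *)

Section GeometricSum.
Context {R : realType}.

Lemma geometric_half_sum N : \sum_(0 <= n < N) (2^-1 : R) ^+ n.+1 = 1 - 2^-1 ^+ N.
Proof.
elim: N => [|N IH]; first by rewrite big_geq// expr0 subrr.
by rewrite big_nat_recr//= IH exprS; lra.
Qed.

Lemma geometric_half_uniq_sum (r : seq nat) : uniq r ->
  \sum_(n <- r) (2^-1 : R) ^+ n.+1 <= 1.
Proof.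
move=> ur; pose N := (\max_(n <- r) n).+1.
have rN n : n \in r -> (n < N)%N by move=> nr; rewrite ltnS; exact: leq_bigmax_seq.
have -> : \sum_(n <- r) (2^-1 : R) ^+ n.+1 =
    \sum_(0 <= n < N | n \in r) (2^-1 : R) ^+ n.+1.
  rewrite -[RHS]big_filter; apply: perm_big; apply: uniq_perm => //.
    by rewrite filter_uniq// iota_uniq.
  move=> n; rewrite mem_filter mem_index_iota.
  by case: (boolP (n \in r)) => // /rN ->.
apply: (@le_trans _ _ (\sum_(0 <= n < N) (2^-1 : R) ^+ n.+1)).
  rewrite [leRHS](bigID (fun n => n \in r))/= lerDl; apply: sumr_ge0 => n _.
  by rewrite exprn_ge0// invr_ge0.
by rewrite geometric_half_sum lerBlDr lerDl exprn_ge0// invr_ge0.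
Qed.

End GeometricSum.

Section IsoGraph.
Context {R : realType}.

(* [G] is the graph of an isomorphism between spaces of continuous functions
   with norm at most [l1] and inverse of norm at most [l2]. *)
Record iso_graph (X Y : topologicalType) (E1 E2 : normedModType R)
    (G : (X -> E1) -> (Y -> E2) -> Prop) (l1 l2 : R) : Prop := IsoGraph {
  graph0 : G 0 0;
  graphL : forall a f f' g g', G f g -> G f' g' -> G (a *: f + f') (a *: g + g');
  graph_contl : forall f g, G f g -> continuous f;
  graph_contr : forall f g, G f g -> continuous g;
  graph_le : forall f g M, 0 <= M -> G f g -> (forall x, `|f x| <= M) ->
    forall y, `|g y| <= l1 * M;
  graph_ge : forall f g M, 0 <= M -> G f g -> (forall y, `|g y| <= M) ->
    forall x, `|f x| <= l2 * M;
  graph_peak : forall x U eps, nbhs x U -> 0 < eps < 1 -> exists h : X -> R,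
    [/\ forall y, 0 <= h y <= 1, 1 - eps < h x, forall y, ~ U y -> h y < eps &
      forall e : E1, exists g, G (fun y => h y *: e) g] }.

Section Facts.
Context {X Y : topologicalType} {E1 : normedModType R} {E2 : completeNormedModType R}.
Variables (G : (X -> E1) -> (Y -> E2) -> Prop) (l1 l2 : R).
Hypothesis GG : iso_graph G l1 l2.
Hypotheses (l10 : 0 <= l1) (l20 : 0 <= l2).

Lemma graphZ a f g : G f g -> G (a *: f) (a *: g).
Proof. by move=> h; have := graphL GG a h (graph0 GG); rewrite !addr0. Qed.

Lemma graphD f g f' g' : G f g -> G f' g' -> G (f + f') (g + g').
Proof. by move=> h h'; have := graphL GG 1 h h'; rewrite !scale1r. Qed.

Lemma graph_sum (I : Type) (r : seq I) (theta : I -> R) f g :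
  (forall i, G (f i) (g i)) ->
  G (\sum_(i <- r) theta i *: f i) (\sum_(i <- r) theta i *: g i).
Proof.
move=> fg; elim: r => [|i r IH]; first by rewrite !big_nil; exact: graph0 GG.
by rewrite !big_cons; exact: (graphL GG).
Qed.

Lemma graph_inj f g g' : G f g -> G f g' -> g = g'.
Proof.
move=> h h'; have := graphD h (graphZ (-1) h'); rewrite !scaleN1r subrr => h0.
apply/funext => y; apply/eqP; rewrite -subr_eq0 -normr_le0 -[leRHS](mulr0 l1).
by apply: (graph_le GG _ h0) => // x; rewrite normr0.
Qed.

Hypotheses (X_haus : hausdorff_space X) (E2_c0 : ~ contains_c0 E2).

Section SmallPeak.
Variables (S U : set X) (x : X) (eps eta : R) (e : E1).
Hypotheses (Sx : limit_point S x) (oU : open U) (Ux : U x) (eps01 : 0 < eps < 1)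
  (eta0 : 0 < eta) (e1 : `|e| <= 1).

(** At each stage an open neighbourhood of [x] disjoint from the sets already chosen is kept, and
    the next point of [S] is taken inside it. *)
Lemma disjoint_neighbourhoods : exists (p : nat -> X) (V : nat -> set X),
  [/\ forall n, S (p n), forall n, nbhs (p n) (V n), forall n, V n `<=` U &
    forall m n z, V m z -> V n z -> m = n].
Proof.
pose state := {W : set X | open W /\ W x}.
have step (W : state) : exists q : (X * set X) * state,
    [/\ S q.1.1, nbhs q.1.1 q.1.2, q.1.2 `<=` sval W `&` U,
        sval q.2 `<=` sval W & q.1.2 `&` sval q.2 = set0].
  case: W => W [oW Wx] /=.
  have oWU : open (W `&` U) by exact: openI.
  have [y [yx Sy WUy]] := Sx (open_nbhs_nbhs (conj oWU (conj Wx Ux))).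
  have [A [B [oA oB Ay Bx AB]]] := hausdorff_disjoint_nbhs X_haus (elimN eqP yx).
  exists ((y, A `&` (W `&` U)), exist _ (B `&` W) (conj (openI oB oW) (conj Bx Wx))).
  split=> //=.
  - by apply: filterI; apply: open_nbhs_nbhs.
  - apply/seteqP; split=> // z [[Az _] [Bz _]].
    by have : (A `&` B) z by []; rewrite AB.
have [g gP] := choice step.
have start : state by exists setT; split => //; exact: openT.
pose st := fix st n : state := if n is m.+1 then (g (st m)).2 else start.
have st_anti m n : (m <= n)%N -> sval (st n) `<=` sval (st m).
  move=> /subnK <-; elim: (n - m)%N => // k IH z.
  by rewrite addSn /=; have [_ _ _ h _] := gP (st (k + m)%N) => /h/IH.
have disj m n z : (m < n)%N -> (g (st m)).1.2 z -> (g (st n)).1.2 z -> False.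
  move=> mn Vm Vn; have [_ _ hn _ _] := gP (st n); have [_ _ _ _ hm] := gP (st m).
  have : set0 z by rewrite -hm; split=> //; apply: (st_anti m.+1 n) => //; have [] := hn _ Vn.
  by [].
exists (fun n => (g (st n)).1.1), (fun n => (g (st n)).1.2); split.
- by move=> n; have [] := gP (st n).
- by move=> n; have [] := gP (st n).
- by move=> n z; have [_ _ h _ _] := gP (st n) => /h[].
- move=> m n z Vm Vn; have [mn|nm|//] := ltngtP m n; exfalso.
    exact: disj mn Vm Vn.
  exact: disj nm Vn Vm.
Qed.

(** Peaks at infinitely many points with disjoint neighbourhoods have sums at most 2, so their
    images at a point form an unconditionally bounded sequence in [E2], which tends to 0 by
    [unconditional_vanishing]. A late enough peak works for all of [F]. *)
Lemma small_peak (F : seq Y) : exists (x' : X) (h : X -> R) (g : Y -> E2),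
  [/\ S x', U x', forall y, 0 <= h y <= 1, 1 - eps < h x' &
    forall y, ~ U y -> h y < eps] /\
  (G (fun y => h y *: e) g /\ forall y, y \in F -> `|g y| < eta).
Proof.
have /andP[eps0 eps1] := eps01.
have [p [V [pS pV VU Vdisj]]] := disjoint_neighbourhoods.
(* A point lies in at most one [V n]; summable errors keep the total of the other peaks there at
   most 1. *)
pose ep n : R := eps * 2^-1 ^+ n.+1.
have ep0 n : 0 < ep n by rewrite mulr_gt0// exprn_gt0// invr_gt0.
have ep_le n : ep n <= eps.
  by rewrite ler_piMr ?(ltW eps0)// exprn_ile1 ?invr_ge0//; lra.
have peak n : exists hg : (X -> R) * (Y -> E2),
    [/\ forall y, 0 <= hg.1 y <= 1, 1 - ep n < hg.1 (p n),
      forall y, ~ V n y -> hg.1 y < ep n & G (fun y => hg.1 y *: e) hg.2].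
  have [|h [h01 hp hV /(_ e) [g hg]]] := graph_peak GG (pV n) (eps := ep n).
    by rewrite ep0/=; exact: le_lt_trans (ep_le n) eps1.
  by exists (h, g).
have [hg hgP] := choice peak.
pose h n := (hg n).1; pose g n := (hg n).2.
have h_sum r z : uniq r -> \sum_(n <- r) h n z <= 2.
  move=> ur.
  have tail s : uniq s -> (forall n, n \in s -> ~ V n z) -> \sum_(n <- s) h n z <= 1.
    move=> us sV; apply: le_trans (geometric_half_uniq_sum us).
    rewrite big_seq [leRHS]big_seq; apply: ler_sum => n /sV nV.
    have [_ _ /(_ z nV) hn _] := hgP n; apply: le_trans (ltW hn) _.
    by rewrite ler_piMl ?exprn_ge0 ?invr_ge0// ltW.
  have [[n [nr Vn]]|noV] := pselect (exists n, n \in r /\ V n z); last first.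
    apply: (@le_trans _ _ 1); last by lra.
    by apply: tail => // n nr Vn; apply: noV; exists n.
  rewrite (bigD1_seq n)//= -big_filter.
  have := tail [seq i <- r | i != n] (filter_uniq _ ur).
  have [/(_ z)/andP[_ hn] _ _ _] := hgP n; rewrite -/(h n z) in hn.
  have {}tail' : forall m, m \in [seq i <- r | i != n] -> ~ V m z.
    by move=> m; rewrite mem_filter => /andP[/eqP mn _] Vm; apply: mn; exact: Vdisj Vm Vn.
  by move=> /(_ tail'); lra.
have bounded y : unconditionally_bounded (fun n => g n y) (l1 * 2).
  move=> r theta ur th1.
  have Gsum := @graph_sum _ r theta (fun n z => h n z *: e) g (fun n => let: And4 _ _ _ k := hgP n in k).
  have := graph_le GG (ler0n _ 2) Gsum.
  have sumE (A : Type) (B : normedModType R) (k : nat -> A -> B) a :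
      (\sum_(n <- r) theta n *: k n) a = \sum_(n <- r) theta n *: k n a.
    by elim: (r) => [|n s IH]; rewrite ?big_nil// !big_cons -IH.
  move=> /(_ _ y); rewrite sumE; apply => z; rewrite sumE.
  apply: le_trans (h_sum r z ur); apply: le_trans (ler_norm_sum _ _ _) _.
  apply: ler_sum => n _; rewrite !normrZ.
  have [/(_ z)/andP[hn _] _ _ _] := hgP n; rewrite -/(h n z) in hn.
  rewrite (ger0_norm hn) mulrA; apply: le_trans (ler_piMr _ e1) _.
    by rewrite mulr_ge0.
  by rewrite ler_piMl.
have small : exists N, forall n, (N <= n)%N -> forall y, y \in F -> `|g n y| < eta.
  elim: (F) => [|y s [N NP]]; first by exists 0%N.
  have [M MP] := unconditional_vanishing E2_c0 (bounded y) eta0.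
  exists (maxn M N) => n; rewrite geq_max => /andP[Mn Nn] y'.
  rewrite inE => /predU1P[->|]; first exact: MP.
  exact: NP.
have [N NP] := small; have [h01 hp hV hG] := hgP N.
exists (p N), (h N), (g N); split; last by split=> //; exact: NP.
split=> //.
- by apply: (VU N); exact: nbhs_singleton.
- apply: le_lt_trans hp; rewrite lerD2l lerN2; exact: ep_le.
- by move=> y Uy; apply: lt_le_trans (hV _ _) (ep_le N) => /VU.
Qed.

End SmallPeak.
End Facts.
End IsoGraph.

(** * Large values on the derivatives and the comparison of their sizes *)

Section Counting.
Context {R : realType}.
Context {X Y : topologicalType} {E1 : normedModType R} {E2 : completeNormedModType R}.
Variables (G : (X -> E1) -> (Y -> E2) -> Prop) (l1 l2 : R).
Hypothesis GG : iso_graph G l1 l2.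
Hypotheses (l10 : 0 <= l1) (l20 : 0 <= l2).
Hypotheses (X_haus : hausdorff_space X) (Y_compact : compact [set: Y])
  (Y_haus : hausdorff_space Y) (E2_c0 : ~ contains_c0 E2).
Context {W : Type} {lt : W -> W -> Prop} (lt_wo : strict_well_order lt).

Section Descent.
Variables (eps eta : R) (c : X -> E1) (ct : Y -> E2) (e : E1) (U0 : set X).
Hypotheses (eps01 : 0 < eps < 1) (eta0 : 0 < eta).
Hypotheses (Gc : G c ct) (e_norm : `|e| = 1) (c_norm : forall x, `|c x| <= 1 + eps)
  (oU0 : open U0) (cU0 : forall x, U0 x -> `|c x - e| <= eps).

(* The image of some function close to [e] on [U] and compatible with [c] is
   small at each point of [L]. *)
Definition killed (L : set Y) (U : set X) := forall y, L y ->
  exists v vt, [/\ G v vt, `|vt y| < eta, forall x, `|c x - 2 *: v x| <= 1 + 3 * eps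
    & forall x, U x -> `|v x - e| <= eps].

(** On [U0], [c] is close to [e] and [1 - 2 * h x] has modulus at most 1; off [U0], [c] has norm at
    most [1 + eps] and the peak adds at most [2 * eps]. *)
Lemma peak_compatible h : (forall x, 0 <= h x <= 1) ->
  (forall x, ~ U0 x -> h x < eps) ->
  forall x, `|c x - 2 *: (h x *: e)| <= 1 + 3 * eps.
Proof.
move=> h01 hU x; have /andP[h0 h1] := h01 x; have /andP[eps0 _] := eps01.
have [Ux|Ux] := pselect (U0 x).
  have -> : c x - 2 *: (h x *: e) = (c x - e) + (1 - 2 * h x) *: e.
    by rewrite scalerBl scale1r scalerA addrA subrK.
  apply: le_trans (ler_normD _ _) _; rewrite normrZ e_norm mulr1.
  have := cU0 Ux; have : `|1 - 2 * h x| <= 1 by rewrite ler_norml; apply/andP; split; lra.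
  lra.
apply: le_trans (ler_normB _ _) _; rewrite !normrZ e_norm mulr1 !ger0_norm//.
by have := c_norm x; have := hU x Ux; lra.
Qed.

(** Some [D j] with [j] below [i] meets [L] in a finite set [F]. A peak at a point of [D j] in [U]
    with image small on [F] takes care of all of [L] except a closed part that misses [D j], where
    induction applies. *)
Lemma descent i : forall x U (L : set Y), derived lt i x -> open U -> U x ->
  U `<=` U0 -> closed L -> L `&` derived lt i = set0 ->
  exists x' U', [/\ open U', U' x', U' `<=` U & killed L U'].
Proof.
have /andP[eps0 eps1] := eps01; have [_ _ lt_wf] := lt_wo.
elim: (lt_wf i) => {}i _ IH x U L Dx oU Ux UU0 cL LD.
have [L0|/set0P L0] := eqVneq L set0.
  by exists x, U; split=> // y; rewrite L0.
have [j ji LDj] := disjoint_derived lt_wo Y_compact Y_haus cL L0 LD.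
have /finite_seqP[F FE] := disjoint_derived_finite Y_compact cL LDj.
have e1 : `|e| <= 1 by rewrite e_norm.
have [x' [h [g [[Dx' Ux' h01 hx' hU] [hg gF]]]]] :=
  small_peak GG X_haus E2_c0 (derived_lim ji Dx) oU Ux eps01 eta0 e1 F.
(* Continuity of [h] is recovered from that of [h] times the unit vector [e]. *)
have hcont : continuous h.
  have hE : h = fun z => `|h z *: e|.
    by apply/funext => z; rewrite normrZ e_norm mulr1 ger0_norm//; have /andP[] := h01 z.
  rewrite hE => z; apply: cvg_norm; exact: (graph_contl GG hg).
pose U' := U `&` [set z | 1 - eps < h z].
pose L' := L `&` [set y | eta <= `|g y|].
have oU' : open U'.
  apply: openI => //.
  rewrite (_ : [set z | _] = h @^-1` [set t | 1 - eps < t])//.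
  by apply: open_comp => // z _; exact: hcont.
have cL' : closed L'.
  apply: closedI => //; rewrite (_ : [set y | _] = (fun y => `|g y|) @^-1` [set t | eta <= t])//.
  apply: closed_comp => // y _; apply: cvg_norm; exact: (graph_contr GG hg).
have L'D : L' `&` derived lt j = set0.
  apply/seteqP; split=> // y [[Ly gy] Dy].
  have : (L `&` derived lt j) y by [].
  by rewrite FE => /gF; rewrite ltNge; apply/negP; rewrite negbK.
have [z [V [oV Vz VU' killV]]] := IH j ji x' U' L' Dx' oU' (conj Ux' hx')
  (fun z (h : U' z) => UU0 z h.1) cL' L'D.
exists z, V; split=> // [y /VU'[]//|y Ly].
have [gy|gy] := leP eta `|g y|; first exact: killV.
exists (fun y => h y *: e), g; split=> //.
  apply: peak_compatible => // w Uw; apply: hU => /UU0; exact: Uw.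
move=> w /VU'[_ /= hw]; have /andP[_ hw1] := h01 w.
have -> : h w *: e - e = (h w - 1) *: e by rewrite scalerBl scale1r.
by rewrite normrZ e_norm mulr1 ler_norml; apply/andP; split; lra.
Qed.

Hypothesis eps_small : l2 * (l1 * (1 + 5 * eps) + 2 * eta) < 3 - 3 * eps.

(** Otherwise [c] plus twice a peak times [e] has norm above [3 - 3 * eps] at [x'], while its image
    at each [y] is within [2 * eta] of the image of a function of norm at most [1 + 5 * eps]; this
    contradicts [eps_small]. *)
Lemma large_on_derived i x : derived lt i x -> U0 x ->
  exists2 y, derived lt i y & eta <= `|ct y|.
Proof.
move=> Dx Ux; apply: contrapT => nolarge; have /andP[eps0 eps1] := eps01.
have ctcont := graph_contr GG Gc.
pose L := [set y | eta <= `|ct y|].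
have cL : closed L.
  rewrite (_ : L = (fun y => `|ct y|) @^-1` [set t | eta <= t])//.
  by apply: closed_comp => // y _; apply: cvg_norm; exact: ctcont.
have LD : L `&` derived lt i = set0.
  by apply/seteqP; split=> // y [Ly Dy]; apply: nolarge; exists y.
have [x' [U' [oU' U'x' U'U0 killU']]] := descent Dx oU0 Ux (@subset_refl _ U0) cL LD.
have [h [h01 hx' hU' /(_ e) [w hw]]] :=
  graph_peak GG (open_nbhs_nbhs (conj oU' U'x')) eps01.
have kill y : exists v vt, [/\ G v vt, `|vt y| < eta,
    forall x, `|c x - 2 *: v x| <= 1 + 3 * eps & forall x, U' x -> `|v x - e| <= eps].
  have [Ly|Ly] := leP eta `|ct y|; first exact: killU'.
  (* Where [ct] is already small, [c] itself serves as [v], since [c - 2 c = - c]. *)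
  exists c, ct; split=> // [z|z /U'U0]; last exact: cU0.
  have -> : c z - 2 *: c z = - c z.
    by rewrite scaler_nat mulr2n opprD addrA subrr add0r.
  by rewrite normrN; have := c_norm z; lra.
have cwle y : `|(ct + 2 *: w) y| <= l1 * (1 + 5 * eps) + 2 * eta.
  have [v [vt [Gv vty cv ve]]] := kill y.
  have Gcwv := graphD GG (graphD GG Gc (graphZ GG 2 hw)) (graphZ GG (-2) Gv).
  have M0 : 0 <= 1 + 5 * eps by lra.
  have := graph_le GG M0 Gcwv.
  (* On [U'] the three differences contribute [eps], [2 * eps] and 1. Off [U'], compatibility gives
     [1 + 3 * eps] and the peak another [2 * eps], whence the constant 5. *)
  have bound z : `|(c + (2 *: (fun y : X => h y *: e)) + (-2) *: v) z| <= 1 + 5 * eps.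
    rewrite !fctE; have /andP[h0 h1] := h01 z.
    have [Uz|Uz] := pselect (U' z).
      have -> : c z + 2 *: (h z *: e) + (-2) *: v z =
          (c z - e) - 2 *: (v z - e) + (2 * h z - 1) *: e.
        rewrite scalerA scaleNr scalerBr opprB scalerBl scale1r.
        rewrite [2 *: e]scaler_nat mulr2n -[e + e - _]addrA subrKA.
        by rewrite [e - _]addrC [(2 * h z) *: e - e]addrC [RHS]addrA [c z + (_ + e)]addrA addrK addrAC.
      apply: le_trans (ler_normD _ _) _.
      have := ler_normB (c z - e) (2 *: (v z - e)).
      rewrite !normrZ e_norm mulr1 (ger0_norm (ler0n _ 2)).
      have := cU0 (U'U0 _ Uz); have := ve z Uz.
      have : `|2 * h z - 1| <= 1 by rewrite ler_norml; apply/andP; split; lra.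
      lra.
    have -> : c z + 2 *: (h z *: e) + (-2) *: v z =
        (c z - 2 *: v z) + 2 *: (h z *: e) by rewrite scaleNr addrAC.
    apply: le_trans (ler_normD _ _) _; rewrite !normrZ e_norm mulr1.
    rewrite (ger0_norm (ler0n _ 2)) (ger0_norm h0).
    by have := cv z; have := hU' z Uz; lra.
  move=> /(_ bound y) h1.
  have -> : (ct + 2 *: w) y = (ct + 2 *: w + (-2) *: vt) y + 2 *: vt y.
    by rewrite !fctE scaleNr subrK.
  apply: le_trans (ler_normD _ _) _; rewrite lerD// normrZ ger0_norm// ler_pM2l//.
  exact: ltW.
have M0 : 0 <= l1 * (1 + 5 * eps) + 2 * eta.
  apply: addr_ge0; first by apply: mulr_ge0 => //; lra.
  by rewrite mulr_ge0// ltW.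
have := graph_ge GG M0 (graphD GG Gc (graphZ GG 2 hw)) cwle x'.
rewrite leNgt => /negP; apply; apply: lt_le_trans eps_small _.
rewrite !fctE; have /andP[h0 h1] := h01 x'.
have -> : c x' + 2 *: (h x' *: e) = (1 + 2 * h x') *: e + (c x' - e).
  by rewrite scalerDl scale1r scalerA [e + _]addrC -addrA [e + _]addrC subrK addrC.
apply: le_trans (lerB_normD _ _); rewrite normrZ e_norm mulr1.
have := cU0 (U'U0 _ U'x'); have := ler_norm (1 + 2 * h x'); lra.
Qed.

End Descent.

Hypothesis l12 : l1 * l2 < 3.

Lemma small_parameters : exists eps eta : R,
  [/\ 0 < eps < 1, 0 < eta & l2 * (l1 * (1 + 5 * eps) + 2 * eta) < 3 - 3 * eps].
Proof.
pose d := 3 - l1 * l2; have d0 : 0 < d by rewrite subr_gt0.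
have p0 : 0 <= l1 * l2 by exact: mulr_ge0.
pose q := 5 * (l1 * l2) + 3; have q0 : 0 < q by rewrite /q; lra.
pose eps := d / (2 * q); pose eta := d / (8 * (l2 + 1)).
have eps0 : 0 < eps by rewrite divr_gt0// mulr_gt0.
have eta0 : 0 < eta by rewrite divr_gt0// mulr_gt0// ltr_wpDl.
have epsE : eps * q = d / 2 by rewrite /eps invfM mulrA mulfVK ?gt_eqF.
have etaE : eta * (l2 + 1) = d / 8.
  by rewrite /eta invfM mulrA mulfVK// gt_eqF// ltr_wpDl.
exists eps, eta; split=> //.
  rewrite eps0/= ltr_pdivrMr ?mulr_gt0// /q /d; lra.
have : l2 * eta <= d / 8 by rewrite -etaE mulrDr mulr1 mulrC lerDl ltW.
have -> : l2 * (l1 * (1 + 5 * eps) + 2 * eta) =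
  l1 * l2 + eps * (5 * (l1 * l2)) + 2 * (l2 * eta) by ring.
have dE : d = 3 - l1 * l2 by [].
by move: epsE; rewrite /q mulrDr; lra.
Qed.

(** A vector [u] gives a sum of peaks at the points of [s] times the [u k]; the embedding takes the
    values of its image on [t]. Its lower bound is [large_on_derived] at a coordinate of largest
    norm. *)
Lemma derived_count i (s : seq X) (t : seq Y) : uniq s ->
  (forall x, x \in s -> derived lt i x) -> derived lt i = [set` t] ->
  contains_power E2 (size t) E1 (size s).
Proof.
move=> us sD tD; have [eps [eta [eps01 eta0 small]]] := small_parameters.
have /andP[eps0 eps1] := eps01.
set n := size s; set m := size t.
pose x_ (k : 'I_n) := tnth (in_tuple s) k; pose y_ (j : 'I_m) := tnth (in_tuple t) j.
have xs k : x_ k \in s by exact: mem_tnth.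
have x_inj : injective x_ by apply/tuple_uniqP.
have [U [xU Udisj]] := hausdorff_separate_seq s X_haus.
(* The other peaks contribute at most [n%:R * ep] and the main one a further [ep], in total
   [eps]. *)
pose ep := eps / n.+1%:R.
have ep0 : 0 < ep by rewrite divr_gt0.
have epn : n%:R * ep + ep = eps.
  by rewrite -{2}[ep]mul1r -mulrDl natr1 mulrC divfK.
have ep1 : ep < 1 by have : 0 <= n%:R * ep by [rewrite mulr_ge0// ltW]; lra.
have peak (k : 'I_n) : exists hg : (X -> R) * (E1 -> Y -> E2),
    [/\ forall z, 0 <= hg.1 z <= 1, 1 - ep < hg.1 (x_ k),
      forall z, ~ U (x_ k) z -> hg.1 z < ep &
      forall e, G (fun z => hg.1 z *: e) (hg.2 e)].
  have [|h [h01 hx hU hg]] := graph_peak GG (xU (x_ k)) (eps := ep).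
    by rewrite ep0.
  by have [g gP] := choice hg; exists (h, g).
have [hg hgP] := choice peak.
pose h k := (hg k).1; pose g k := (hg k).2.
have h01 k z : 0 <= h k z <= 1 by have [h1 _ _ _] := hgP k; exact: h1.
have hU k z : ~ U (x_ k) z -> h k z < ep by have [_ _ h3 _] := hgP k; exact: h3.
have hG k e : G (fun z => h k z *: e) (g k e) by have [_ _ _ h4] := hgP k; exact: h4.
pose c (u : 'I_n -> E1) z := \sum_k h k z *: u k.
pose ct (u : 'I_n -> E1) y := \sum_k g k (u k) y.
have Gc u : G (c u) (ct u).
  have := @graph_sum _ _ _ _ _ _ _ _ GG _ (index_enum 'I_n) (fun=> 1)
    (fun k z => h k z *: u k) (fun k => g k (u k)) (fun k => hG k (u k)).
  congr G; apply/funext => z; rewrite fct_sumE; apply: eq_bigr => k _.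
    by rewrite scale1r.
  by rewrite scale1r.
(* The images [g k e] are chosen separately for each [e]; linearity follows since [G] determines the
   image. *)
have ctL a u v : ct (a *: u + v) = a *: ct u + ct v.
  apply: (graph_inj GG (Gc (a *: u + v))); have := graphL GG a (Gc u) (Gc v).
  congr G; apply/funext => z; rewrite /c !fctE scaler_sumr -big_split.
  by apply: eq_bigr => k _; rewrite scalerDr !scalerA mulrC.
have others k z l : U (x_ k) z -> l != k -> h l z < ep.
  move=> Uk lk; apply: hU => Ul; move/eqP: lk; apply; apply: x_inj.
  exact: Udisj Ul Uk.
have sum_ep : \sum_(k < n) ep = n%:R * ep by rewrite sumr_const card_ord mulr_natl.
have h_sum z : \sum_k h k z <= 1 + eps.
  have nep0 : 0 <= n%:R * ep by rewrite mulr_ge0// ltW.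
  have [[k0 Uk0]|noU] := pselect (exists k, U (x_ k) z); last first.
    apply: (@le_trans _ _ (\sum_(k < n) ep)); last by rewrite sum_ep; lra.
    by apply: ler_sum => k _; apply/ltW/hU => Uk; apply: noU; exists k.
  rewrite (bigD1 k0)//=; have /andP[_ h1] := h01 k0 z.
  have : \sum_(k | k != k0) h k z <= n%:R * ep.
    apply: (@le_trans _ _ (\sum_(k < n | k != k0) ep)).
      by apply: ler_sum => k kk0; apply: ltW; exact: others Uk0 kk0.
    by rewrite -sum_ep [leRHS](bigD1 k0)//= lerDr ltW.
  by lra.
have bnd (u : 'I_n -> E1) : bounded_funs 'I_n E1 u.
  exists (\sum_k `|u k|) => k; rewrite (bigD1 k)//= lerDl.
  exact: sumr_ge0.
have c_le u z : `|c u z| <= supnorm u * (1 + eps).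
  apply: le_trans (ler_norm_sum _ _ _) _.
  apply: (@le_trans _ _ (\sum_k supnorm u * h k z)); last first.
    by rewrite -mulr_sumr ler_wpM2l ?supnorm_ge0.
  apply: ler_sum => k _; have /andP[h0 _] := h01 k z.
  by rewrite normrZ ger0_norm// mulrC ler_wpM2r// le_supnorm.
pose T (u : [set: 'I_n -> E1]) : 'I_m -> E2 := fun j => ct (val u) (y_ j).
exists T.
  move=> a u v w; rewrite !set_valE => wE; apply/funext => j.
  by rewrite /T wE ctL.
(* The upper constant dominates [l1 * (1 + eps)]; the added 1 keeps it positive when [l1 = 0]. *)
exists eta, (l1 * 2 + 1); split=> // [|u]; first by have := l10; lra.
rewrite set_valE; set v : 'I_n -> E1 := val u; have v0 := supnorm_ge0 v.
have bndT : bounded_funs 'I_m E2 (T u).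
  exists (\sum_j `|T u j|) => j; rewrite (bigD1 j)//= lerDl; exact: sumr_ge0.
split; last first.
  apply: supnorm_le; first by rewrite mulr_ge0//; have := l10; lra.
  move=> j; apply: le_trans (graph_le GG _ (Gc v) (c_le v) (y_ j)) _.
    by rewrite mulr_ge0//; lra.
  rewrite mulrCA [leRHS]mulrC ler_wpM2l//.
  apply: (@le_trans _ _ (l1 * 2)); last by lra.
  by rewrite ler_wpM2l//; lra.
have [->|vn0] := eqVneq (supnorm v) 0; first by rewrite mulr0 supnorm_ge0.
have vp : 0 < supnorm v by rewrite lt_neqAle eq_sym vn0.
have [k0 vk0] : exists k0, `|v k0| = supnorm v.
  have [k1 _] : exists k : 'I_n, True.
    apply: contrapT => nok; move: vn0; rewrite (_ : supnorm v = 0) ?eqxx//.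
    by apply/eqP; rewrite eq_le v0 andbT; apply: supnorm_le => // k; exfalso; apply: nok; exists k.
  have [k _ kmax] := @arg_maxP _ _ _ k1 xpredT (fun k => `|v k|) isT.
  exists k; apply/eqP; rewrite eq_le le_supnorm//=.
  by apply: supnorm_le => // l; exact: kmax.
pose r := (supnorm v)^-1; have r0 : 0 < r by rewrite invr_gt0.
pose e := r *: v k0.
pose U0 := interior (U (x_ k0)) `&` [set z | 1 - ep < h k0 z].
have e_norm : `|e| = 1 by rewrite normrZ gtr0_norm// vk0 mulVf.
have hcont : continuous (h k0).
  have hE : h k0 = fun z => `|h k0 z *: e|.
    by apply/funext => z; rewrite normrZ e_norm mulr1 ger0_norm//; have /andP[] := h01 k0 z.
  rewrite hE => z; apply: cvg_norm; exact: (graph_contl GG (hG k0 e)).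
have oU0 : open U0.
  apply: openI; first exact: open_interior.
  rewrite (_ : [set z | _] = h k0 @^-1` [set t | 1 - ep < t])//.
  by apply: open_comp => // z _; exact: hcont.
have U0x : U0 (x_ k0) by split; [exact: xU|have [] := hgP k0].
have c_norm z : `|(r *: c v) z| <= 1 + eps.
  rewrite normrZ gtr0_norm// ler_pdivrMl//; exact: c_le.
have cU0 z : U0 z -> `|(r *: c v) z - e| <= eps.
  move=> [/interior_subset Uz /= hz]; rewrite -scalerBr normrZ gtr0_norm//.
  rewrite ler_pdivrMl//.
  have -> : c v z - v k0 = (h k0 z - 1) *: v k0 + \sum_(k | k != k0) h k z *: v k.
    by rewrite /c (bigD1 k0)//= scalerBl scale1r addrAC.
  apply: le_trans (ler_normD _ _) _.
  have h1 : `|(h k0 z - 1) *: v k0| <= supnorm v * ep.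
    rewrite normrZ vk0 mulrC ler_pM2l// ler_norml; have /andP[_ ?] := h01 k0 z.
    by apply/andP; split; lra.
  have h2 : `|\sum_(k | k != k0) h k z *: v k| <= supnorm v * (n%:R * ep).
    apply: le_trans (ler_norm_sum _ _ _) _.
    apply: (@le_trans _ _ (\sum_(k < n | k != k0) supnorm v * ep)).
      apply: ler_sum => k kk0; have /andP[hk0 _] := h01 k z.
      rewrite normrZ ger0_norm// mulrC ler_pM//; first exact: le_supnorm.
      by apply: ltW; exact: others Uz kk0.
    rewrite -mulr_sumr ler_pM2l// -sum_ep [leRHS](bigD1 k0)//= lerDr ltW//.
  apply: le_trans (lerD h1 h2) _.
  by rewrite -mulrDr addrC epn.
have [y Dy] := large_on_derived eps01 eta0 (graphZ GG r (Gc v)) e_norm c_norm oU0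
  cU0 small (sD _ (xs k0)) U0x.
rewrite normrZ gtr0_norm// ler_pdivlMl// mulrC => /le_trans; apply.
have [j <-] : exists j, y_ j = y.
  have yt : y \in t by move: Dy; rewrite tD.
  by have /tnthP[j ->] : y \in in_tuple t by []; exists j.
exact: (le_supnorm j bndT).
Qed.

End Counting.

(** * Functions on the Choquet boundaries *)

Section Subtype.
Context {T : topologicalType} (A : set T).

Lemma nbhs_set_type (x : A) (U : set A) : nbhs x U ->
  exists2 V, nbhs (val x) V & forall y : A, V (val y) -> U y.
Proof.
case=> _ /= [[W oW <-] Wx WU]; exists W; last by move=> y Wy; exact: WU.
by apply: open_nbhs_nbhs.
Qed.

Lemma set_val_continuous : continuous (val : A -> T).
Proof. exact: initial_continuous. Qed.

Lemma set_type_hausdorff : hausdorff_space T -> hausdorff_space A.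
Proof.
move=> hT x y clxy; apply: val_inj; apply: hT => P Q xP yQ.
have [z [Pz Qz]] := clxy _ _ (set_val_continuous xP) (set_val_continuous yQ).
by exists (val z).
Qed.

Lemma set_type_compact : compact A -> compact [set: A].
Proof.
move=> cA F FF _.
have FA : (val @ F) A.
  by suff : F (val @^-1` A) by []; apply: filterE => y; exact: set_valP.
have [z [Az clz]] := cA (val @ F) _ FA.
exists (SigSub (mem_set Az)); split=> // P U FP /nbhs_set_type[V zV VU].
have [|y [[w Pw <-] Vw]] := clz (val @` P) V _ zV.
  suff : F (val @^-1` (val @` P)) by [].
  by apply: filterS FP => w Pw; exists w.
by exists w; split=> //; exact: VU.
Qed.

Lemma set_type_countable : countable A -> countable [set: A].
Proof. by rewrite (eq_countable (card_setT A)). Qed.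

End Subtype.

Section Restriction.
Context {R : realType} {K1 K2 : topologicalType} {E1 E2 : completeNormedModType R}.
Variables (H1 : set (K1 -> E1)) (H2 : set (K2 -> E2)).
Hypotheses (K1_compact : compact [set: K1]) (K2_compact : compact [set: K2]).
Hypotheses (H1_closed : closed_function_space H1)
  (H2_closed : closed_function_space H2).

(** As a relation, [T] can be moved to the boundaries without inverting the restriction of
    functions. *)
Definition choquet_graph (T : H1 -> H2) (f : choquet_boundary H1 -> E1)
    (g : choquet_boundary H2 -> E2) :=
  exists h : H1, f = (fun x => set_val h (val x)) /\
    g = (fun y => set_val (T h) (val y)).

Lemma function_space_bounded (K : topologicalType) (E : completeNormedModType R)
    (H : set (K -> E)) : compact [set: K] -> closed_function_space H ->
  H `<=` bounded_funs K E.
Proof. by move=> cK [Hc _ _] h /Hc; exact: compact_bounded_funs. Qed.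

Lemma choquet_supnorm_le (K : topologicalType) (E : completeNormedModType R)
    (H : set (K -> E)) h M : compact [set: K] -> closed_function_space H ->
  H h -> 0 <= M -> (forall x, choquet_boundary H x -> `|h x| <= M) ->
  supnorm h <= M.
Proof.
move=> cK Hc Hh M0 hM; apply: supnorm_le => // x.
have [->|hx0] := eqVneq (h x) 0; first by rewrite normr0.
by have [z /hM zM /le_trans] := choquet_norming cK Hc Hh hx0; apply.
Qed.

Lemma isomorphism_pair_sym (T : H1 -> H2) (S : H2 -> H1) :
  isomorphism_pair T S -> isomorphism_pair S T.
Proof.
move=> [TS ST TL Tb Sb]; split=> // a u v w wE.
have HH1 := function_space_subspace H1_closed.
have HuV := HH1.2 a _ _ (set_valP (S u)) (set_valP (S v)).
suff -> : S w = set_elt HuV by [].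
rewrite -[RHS]TS; congr S; apply: val_inj.
have := TL a (S u) (S v) (set_elt HuV) erefl.
by rewrite !ST set_valE => ->; rewrite -wE.
Qed.

Section OpnormBound.
Variables (T : H1 -> H2) (TL : linear_on (fun h => set_val (T h)))
  (Tb : bounded_on (@supnorm R K1 E1) (@supnorm R K2 E2) (fun h => set_val (T h))).

Let supnormZ1 a u : H1 u -> supnorm (a *: u) = `|a| * supnorm u.
Proof. by move=> /(function_space_bounded K1_compact H1_closed); exact: supnormZ. Qed.

Lemma function_opnorm_ge0 : 0 <= function_opnorm T.
Proof.
apply: (opnorm_ge0 (function_space_subspace H1_closed) Tb supnormZ1);
  exact: supnorm_ge0.
Qed.

Lemma le_function_opnorm (h : H1) :
  supnorm (set_val (T h)) <= function_opnorm T * supnorm (set_val h).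
Proof.
apply: (le_opnorm (function_space_subspace H1_closed) TL Tb supnormZ1).
  exact: supnorm_ge0.
move=> a u; apply: supnormZ; apply: (function_space_bounded K2_compact H2_closed).
exact: set_valP.
Qed.

End OpnormBound.

End Restriction.

(** By [choquet_norming], bounds on the boundaries control the sup norms on [K1] and [K2]. The weak
    peak functions are multipliers, so their products with vectors of [E1] lie in [H1]. *)
Lemma choquet_iso_graph (R : realType) (K1 K2 : topologicalType)
    (E1 E2 : completeNormedModType R) (H1 : set (K1 -> E1)) (H2 : set (K2 -> E2))
    (T : H1 -> H2) (S : H2 -> H1) :
  compact [set: K1] -> compact [set: K2] ->
  closed_function_space H1 -> closed_function_space H2 ->
  choquet_boundary H1 `<=` weak_peak_point H1 -> isomorphism_pair T S ->
  iso_graph (choquet_graph T) (function_opnorm T) (function_opnorm S).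
Proof.
move=> cK1 cK2 H1c H2c peak TSpair; have [TS ST TL Tb Sb] := TSpair.
have [_ _ SL _ _] := isomorphism_pair_sym H1c TSpair.
have HH1 := function_space_subspace H1c.
have cont1 : H1 `<=` [set h | continuous h] by have [] := H1c.
have cont2 : H2 `<=` [set h | continuous h] by have [] := H2c.
have T0 := function_opnorm_ge0 cK1 H1c Tb.
have S0 := function_opnorm_ge0 cK2 H2c Sb.
have restr_cont (K : topologicalType) (E : completeNormedModType R) (C : set K)
    (h : K -> E) : continuous h -> continuous (fun x : C => h (val x)).
  by move=> ch x; apply: continuous_comp; [exact: set_val_continuous|exact: ch].
split.
- exists (set_elt HH1.1); split; apply/funext => // y.
  by rewrite (linear_on0 TL).
- move=> a f f' g g' [h [-> ->]] [h' [-> ->]].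
  have Hh := HH1.2 a _ _ (set_valP h) (set_valP h').
  exists (set_elt Hh); split; apply/funext => // y.
  by rewrite (TL a h h' (set_elt Hh) erefl).
- by move=> f g [h [-> _]]; apply: restr_cont; apply: cont1; exact: set_valP.
- by move=> f g [h [_ ->]]; apply: restr_cont; apply: cont2; exact: set_valP.
- move=> f g M M0 [h [-> ->]] fM y.
  have hM : supnorm (set_val h) <= M.
    apply: (choquet_supnorm_le cK1 H1c) => //; first exact: set_valP.
    by move=> x Cx; exact: (fM (SigSub (mem_set Cx))).
  apply: le_trans (le_supnorm _ _) _.
    by apply: (function_space_bounded cK2 H2c); exact: set_valP.
  apply: le_trans (le_function_opnorm cK1 cK2 H1c H2c TL Tb h) _.
  by rewrite ler_wpM2l.
- move=> f g M M0 [h [-> ->]] gM x.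
  have hM : supnorm (set_val (T h)) <= M.
    apply: (choquet_supnorm_le cK2 H2c) => //; first exact: set_valP.
    by move=> y Cy; exact: (gM (SigSub (mem_set Cy))).
  apply: le_trans (le_supnorm _ _) _.
    by apply: (function_space_bounded cK1 H1c); exact: set_valP.
  have := le_function_opnorm cK2 cK1 H2c H1c SL Sb (T h).
  by rewrite TS => /le_trans; apply; rewrite ler_wpM2l.
- move=> x U eps /nbhs_set_type[V xV VU] eps01.
  have [h [[_ hH] h01 hx hV]] := peak _ (set_valP x) V eps xV eps01.
  exists (fun y => h (val y)); split=> //.
    by move=> y Uy; apply: hV; split; [exact: set_valP|move=> /VU].
  move=> e; exists (fun y => set_val (T (set_elt (hH e))) (val y)).
  by exists (set_elt (hH e)).
Qed.

(** The two counting hypotheses, at the index of the last nonempty derivative of [X], show that the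
    derivative of [Y] there is finite with the same number of points. *)
Lemma derived_cb_equiv (R : realType) (W : Type) (lt : W -> W -> Prop)
    (X Y : topologicalType) : strict_well_order lt ->
  compact [set: X] -> hausdorff_space X -> countable [set: X] ->
  (forall f : W -> X, ~ injective f) ->
  compact [set: Y] -> hausdorff_space Y -> countable [set: Y] ->
  (forall f : W -> Y, ~ injective f) ->
  (forall i (s : seq X) (t : seq Y), uniq s ->
     (forall x, x \in s -> derived lt i x) -> derived lt i = [set` t] ->
     (size s <= size t)%N) ->
  (forall i (s : seq X) (t : seq Y), uniq t ->
     (forall y, y \in t -> derived lt i y) -> derived lt i = [set` s] ->
     (size t <= size s)%N) ->
  cb_equiv (lt := lt) [set: X] [set: Y].
Proof.
move=> wo cX hX ctX sX cY hY ctY sY XY YX.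
have clopenT (Z : topologicalType) : clopen [set: Z].
  by split; [exact: openT|exact: closedT].
have [X0|/set0P X0] := eqVneq [set: X] set0.
  left; split=> //; apply/eqP/negPn/negP => /set0P Y0.
  have [i [t [t0 ut]]] := cb_type_exists wo cY hY (R := R) ctY sY (clopenT Y) Y0.
  rewrite setTI => tE.
  have := YX i [::] t ut; rewrite leqNgt t0 => /(_ _ _)/negP[]//.
    by move=> y yt; rewrite tE.
  by apply/seteqP; split=> // x _; have : [set: X] x by []; rewrite X0.
have [i [s [s0 us]]] := cb_type_exists wo cX hX (R := R) ctX sX (clopenT X) X0.
rewrite setTI => sE; right.
(* An infinite derivative would contain [(size s).+1] distinct points, too many for [YX]. *)
have finY : finite_set (derived lt i : set Y).
  apply: contrapT => /infiniteP/card_leP[f].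
  pose g (n : nat) : Y := val (f (SigSub (mem_set (I : [set: nat] n)))).
  have g_inj : injective g.
    by move=> m n /val_inj/(inj (in_setT _) (in_setT _))/(congr1 val).
  have : (size (map g (iota 0 (size s).+1)) <= size s)%N.
    apply: YX sE; first by rewrite map_inj_uniq// iota_uniq.
    by move=> _ /mapP[n _ ->]; exact: set_valP.
  by rewrite size_map size_iota ltnn.
have /finite_seqP[t0 t0E] := finY.
have tE : derived lt i = [set` undup t0].
  by rewrite t0E; apply/seteqP; split=> y /=; rewrite mem_undup.
have st : size s = size (undup t0).
  apply/eqP; rewrite eqn_leq (XY i)//; last by move=> x xs; rewrite sE.
  by rewrite (YX i)// ?undup_uniq// => y yt; rewrite tE.
exists i, s, (undup t0); split=> //; split; rewrite ?setTI//.
  by rewrite -st.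
exact: undup_uniq.
Qed.

Theorem theorem1p2 (R : realType) (K1 K2 : topologicalType)
    (E1 E2 : completeNormedModType R)
    (H1 : set (K1 -> E1)) (H2 : set (K2 -> E2))
    (K1_compact : compact [set: K1]) (K1_hausdorff : hausdorff_space K1)
    (K2_compact : compact [set: K2]) (K2_hausdorff : hausdorff_space K2)
    (E1_nontrivial : nontrivial [set: E1])
    (E2_nontrivial : nontrivial [set: E2])
    (E1_c0 : ~ contains_c0 E1) (E2_c0 : ~ contains_c0 E2)
    (H1_closed : closed_function_space H1)
    (H2_closed : closed_function_space H2)
    (H1_nontrivial : nontrivial H1) (H2_nontrivial : nontrivial H2)
    (Ch1_closed : closed (choquet_boundary H1))
    (Ch2_closed : closed (choquet_boundary H2))
    (Ch1_countable : countable (choquet_boundary H1))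
    (Ch2_countable : countable (choquet_boundary H2))
    (Ch1_peak : choquet_boundary H1 `<=` weak_peak_point H1)
    (Ch2_peak : choquet_boundary H2 `<=` weak_peak_point H2)
    (E1_powers : forall m n : nat, (m < n)%N -> ~ contains_power E1 m E2 n)
    (E2_powers : forall m n : nat, (m < n)%N -> ~ contains_power E2 m E1 n)
    (H1_H2_iso : exists (T : H1 -> H2) (S : H2 -> H1),
       isomorphism_pair T S /\
       function_opnorm T * function_opnorm S < 3) :
  homeomorphic (choquet_boundary H1) (choquet_boundary H2).
Proof.
have [T [S [TS TS3]]] := H1_H2_iso.
have ST := isomorphism_pair_sym H1_closed TS.
have [_ _ _ Tb Sb] := TS.
have [W [lt [wo W_large]]] := exists_large_well_order R.
have c1 : compact [set: choquet_boundary H1].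
  by apply: set_type_compact; exact: subclosed_compact K1_compact _.
have c2 : compact [set: choquet_boundary H2].
  by apply: set_type_compact; exact: subclosed_compact K2_compact _.
have h1 : hausdorff_space (choquet_boundary H1) by exact: set_type_hausdorff.
have h2 : hausdorff_space (choquet_boundary H2) by exact: set_type_hausdorff.
have ct1 := set_type_countable Ch1_countable.
have ct2 := set_type_countable Ch2_countable.
have T0 := function_opnorm_ge0 K1_compact H1_closed Tb.
have S0 := function_opnorm_ge0 K2_compact H2_closed Sb.
have G12 := choquet_iso_graph K1_compact K2_compact H1_closed H2_closed Ch1_peak TS.
have G21 := choquet_iso_graph K2_compact K1_compact H2_closed H1_closed Ch2_peak ST.
have TS3' : function_opnorm S * function_opnorm T < 3 by rewrite mulrC.
apply: (cb_equiv_homeomorphic R wo c1 h1 ct1 (W_large _ ct1) c2 h2 ct2 (W_large _ ct2)).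
apply: (derived_cb_equiv R wo c1 h1 ct1 (W_large _ ct1) c2 h2 ct2 (W_large _ ct2)).
(* More points on the first boundary than on the second would embed a power of [E1] into a smaller
   power of [E2]. *)
- move=> i s t us sD tD; rewrite leqNgt; apply/negP => /E2_powers; apply.
  exact: (derived_count G12 T0 S0 h1 c2 h2 E2_c0 wo TS3 us sD tD).
- move=> i s t ut tD sD; rewrite leqNgt; apply/negP => /E1_powers; apply.
  exact: (derived_count G21 S0 T0 h2 c1 h1 E1_c0 wo TS3' ut tD sD).
Qed.
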